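(* Let $k$ be a field, let $\ell\ge 1$ be an integer, and let $(\Delta,\pi)$ be a balanced simplicial complex of dimension $d-1$ with ordered partition $\pi=(V_1,\dots,V_d)$. If $k[\Delta]$ satisfies Serre's condition $(S_\ell)$, then $k[\Delta_S]$ satisfies $(S_\ell)$ for every $S\subseteq [d]=\{1,\dots,d\}$.
   Context: Simplicial complexes are finite, contain the empty face $\varnothing$, and contain $\{v\}$ for every vertex $v$. $k[\Delta]$ denotes the Stanley-Reisner ring of $\Delta$ over $k$, i.e. $k[x_v : v\in V(\Delta)]$ modulo the ideal generated by the squarefree monomials $\prod_{v\in \sigma}x_v$ with $\sigma\notin\Delta$. A balanced simplicial complex of dimension $d-1$ is a pair $(\Delta,\pi)$ where $\Delta$ is a $(d-1)$-dimensional simplicial complex on vertex set $V$, $\pi=(V_1,\dots,V_d)$ is an ordered partition of $V$, and $|F\cap V_i|\le 1$ for every face $F\in\Delta$ and every $i\in[d]$. For $S\subseteq[d]$, the $S$-rank selected subcomplex is the induced subcomplex $\Delta_S=\{\sigma\in\Delta : \sigma\subseteq \bigcup_{i\in S}V_i\}$. A commutative Noetherian ring $R$ satisfies Serre's condition $(S_\ell)$ if $\operatorname{depth} R_{\mathfrak p}\ge \min\{\ell,\dim R_{\mathfrak p}\}$ for all $\mathfrak p\in\operatorname{Spec} R$. *)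

(* Defs.v *)
From HB Require Import structures.
From mathcomp Require Import all_boot all_order all_algebra.
From mathcomp Require Import boolp.
From mathcomp Require Import mpoly.
From mathcomp Require Import ring.

Set Implicit Arguments.
Unset Strict Implicit.
Unset Printing Implicit Defensive.

Import GRing.Theory.
Local Open Scope ring_scope.
Local Open Scope quotient_scope.

(* Extended natural numbers: [None] is infinity. *)
Definition enat : Type := option nat.

Definition ele (x y : enat) : bool :=
  match x, y with
  | _, None => true
  | None, Some _ => false
  | Some m, Some n => (m <= n)%N
  end.

Definition emin (x y : enat) : enat := if ele x y then x else y.

(* Least upper bound of [A] in the extended natural numbers; the empty set has
   supremum [Some 0]. *)
Definition esup (A : nat -> Prop) : enat :=
  match pselect (exists m, `[< forall n, A n -> (n <= m)%N >]) with
  | left bounded => Some (ex_minn bounded)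
  | right _ => None
  end.

Definition ideal_gen (R : comNzRingType) (G : R -> Prop) (x : R) : Prop :=
  exists (n : nat) (c g : 'I_n -> R),
    (forall i, G (g i)) /\ x = \sum_(i < n) c i * g i.

Definition ideal_seq (R : comNzRingType) (s : seq R) : R -> Prop :=
  ideal_gen (fun g => g \in s).

(* s_i is a nonzerodivisor on R/(s_0, ..., s_(i-1)) for all i, and
   R/(s_0, ..., s_(n-1)) is nonzero. *)
Definition regular_seq (R : comNzRingType) (s : seq R) : Prop :=
  (forall i, (i < size s)%N ->
     forall a, ideal_seq (take i s) (s`_i * a) -> ideal_seq (take i s) a)
  /\ ~ ideal_seq s 1.

(* When R is local, the nonunits form its maximal ideal. *)
Definition nonunit (R : comNzRingType) (x : R) : Prop :=
  ~ exists y, x * y = 1.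

(* Depth of a Noetherian local ring R on itself: supremum of the lengths of the
   regular sequences contained in the maximal ideal. *)
Definition depth (R : comNzRingType) : enat :=
  esup (fun n => exists s : seq R,
    [/\ size s = n, forall x, x \in s -> nonunit x & regular_seq s]).

Definition strict_sub (R : comNzRingType) (p q : prime_idealr R) : Prop :=
  {subset p <= q} /\ ~ {subset q <= p}.

(* Only p 0, ..., p n matter. *)
Definition prime_chain (R : comNzRingType) (n : nat)
    (p : nat -> prime_idealr R) : Prop :=
  forall i, (i < n)%N -> strict_sub (p i) (p i.+1).

Definition krull_dim (R : comNzRingType) : enat :=
  esup (fun n => exists p : nat -> prime_idealr R, prime_chain n p).

(* Localization at a prime ideal: fractions a/s with s outside p, where
   a/s = b/t iff u(at - bs) = 0 for some u outside p. *)
Section Localization.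
Variables (R : comNzRingType) (p : prime_idealr R).

Definition denom := {s : R | s \notin p}.
Definition frac : Type := (R * denom)%type.
HB.instance Definition _ := Choice.on frac.

Lemma denom1_subproof : (1 : R) \notin p.
Proof. by rewrite idealr1. Qed.

Lemma denomM_subproof (s t : denom) : sval s * sval t \notin p.
Proof. by rewrite prime_idealrM negb_or (valP s) (valP t). Qed.

Definition denom1 : denom :=
  exist (fun s : R => s \notin p) 1 denom1_subproof.
Definition denomM (s t : denom) : denom :=
  exist (fun s : R => s \notin p) (sval s * sval t) (denomM_subproof s t).

Definition frac_equiv (x y : frac) : bool :=
  `[< exists2 u : R, u \notin p & u * (x.1 * sval y.2 - y.1 * sval x.2) = 0 >].

Lemma frac_equivI (x y : frac) :
  x.1 * sval y.2 = y.1 * sval x.2 -> frac_equiv x y.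
Proof.
move=> e; apply/asboolP; exists 1; first exact: denom1_subproof.
by rewrite e subrr mulr0.
Qed.

Lemma frac_equiv_is_equiv : equiv_class_of frac_equiv.
Proof.
have sym x y : frac_equiv x y -> frac_equiv y x.
  move=> /asboolP[u up e]; apply/asboolP; exists u => //.
  by rewrite -opprB mulrN e oppr0.
split=> [x|x y|y x z]; first exact: frac_equivI.
  by apply/idP/idP => /sym.
move=> /asboolP[u up e] /asboolP[v vp f]; apply/asboolP.
exists (u * v * sval y.2).
  by rewrite !prime_idealrM !negb_or up vp (valP y.2).
transitivity (v * sval z.2 * (u * (x.1 * sval y.2 - y.1 * sval x.2))
   + u * sval x.2 * (v * (y.1 * sval z.2 - z.1 * sval y.2)));
  first by ring.
by rewrite e f !mulr0 addr0.
Qed.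

Canonical frac_equiv_equiv := EquivRelPack frac_equiv_is_equiv.
Canonical frac_equiv_encModRel := defaultEncModRel frac_equiv.

Definition localization : Type := {eq_quot frac_equiv}.
HB.instance Definition _ := EqQuotient.on localization.
HB.instance Definition _ := Choice.on localization.

Definition frac_zero : frac := (0, denom1).
Definition frac_one : frac := (1, denom1).
Definition frac_opp (x : frac) : frac := (- x.1, x.2).
Definition frac_add (x y : frac) : frac :=
  (x.1 * sval y.2 + y.1 * sval x.2, denomM x.2 y.2).
Definition frac_mul (x y : frac) : frac := (x.1 * y.1, denomM x.2 y.2).

Definition loc_zero : localization := lift_cst localization frac_zero.
Definition loc_one : localization := lift_cst localization frac_one.
Definition loc_opp := lift_op1 localization frac_opp.
Definition loc_add := lift_op2 localization frac_add.
Definition loc_mul := lift_op2 localization frac_mul.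

Canonical pi_loc_zero_morph := PiConst loc_zero.
Canonical pi_loc_one_morph := PiConst loc_one.

Lemma loc_eqP (x y : frac) :
  reflect (\pi_localization x = \pi_localization y) (frac_equiv x y).
Proof. exact: (@eqquotP _ _ localization x y). Qed.

Lemma frac_equiv_repr (x : frac) : frac_equiv (repr (\pi_localization x)) x.
Proof. by apply/loc_eqP; rewrite reprK. Qed.

Lemma pi_loc_opp :
  {morph \pi_localization : x / frac_opp x >-> loc_opp x}.
Proof.
move=> x; unlock loc_opp; apply/esym/loc_eqP.
have /asboolP[u up e] := frac_equiv_repr x.
apply/asboolP; exists u => //=.
move: (repr (\pi_localization x)) e => r e.
by transitivity (- (u * (r.1 * sval x.2 - x.1 * sval r.2)));
  [ring | rewrite e oppr0].
Qed.
Canonical pi_loc_opp_morph := PiMorph1 pi_loc_opp.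

Lemma pi_loc_add :
  {morph \pi_localization : x y / frac_add x y >-> loc_add x y}.
Proof.
move=> x y; unlock loc_add; apply/esym/loc_eqP.
have /asboolP[u up e] := frac_equiv_repr x.
have /asboolP[v vp f] := frac_equiv_repr y.
apply/asboolP; exists (u * v).
  by rewrite prime_idealrM negb_or up vp.
move: (repr (\pi_localization x)) (repr (\pi_localization y)) e f => r t e f /=.
transitivity (v * sval y.2 * sval t.2 * (u * (r.1 * sval x.2 - x.1 * sval r.2))
   + u * sval x.2 * sval r.2 * (v * (t.1 * sval y.2 - y.1 * sval t.2)));
  first by ring.
by rewrite e f !mulr0 addr0.
Qed.
Canonical pi_loc_add_morph := PiMorph2 pi_loc_add.

Lemma pi_loc_mul :
  {morph \pi_localization : x y / frac_mul x y >-> loc_mul x y}.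
Proof.
move=> x y; unlock loc_mul; apply/esym/loc_eqP.
have /asboolP[u up e] := frac_equiv_repr x.
have /asboolP[v vp f] := frac_equiv_repr y.
apply/asboolP; exists (u * v).
  by rewrite prime_idealrM negb_or up vp.
move: (repr (\pi_localization x)) (repr (\pi_localization y)) e f => r t e f /=.
transitivity (v * t.1 * sval y.2 * (u * (r.1 * sval x.2 - x.1 * sval r.2))
   + u * x.1 * sval r.2 * (v * (t.1 * sval y.2 - y.1 * sval t.2)));
  first by ring.
by rewrite e f !mulr0 addr0.
Qed.
Canonical pi_loc_mul_morph := PiMorph2 pi_loc_mul.

Lemma loc_addA : associative loc_add.
Proof.
move=> x y z; rewrite -[x]reprK -[y]reprK -[z]reprK !piE.
by apply/loc_eqP/frac_equivI => /=; ring.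
Qed.

Lemma loc_addC : commutative loc_add.
Proof.
move=> x y; rewrite -[x]reprK -[y]reprK !piE.
by apply/loc_eqP/frac_equivI => /=; ring.
Qed.

Lemma loc_add0 : left_id loc_zero loc_add.
Proof.
move=> x; rewrite -[x]reprK !piE.
by apply/loc_eqP/frac_equivI => /=; ring.
Qed.

Lemma loc_addN : left_inverse loc_zero loc_opp loc_add.
Proof.
move=> x; rewrite -[x]reprK !piE.
by apply/loc_eqP/frac_equivI => /=; ring.
Qed.

HB.instance Definition _ :=
  GRing.isZmodule.Build localization loc_addA loc_addC loc_add0 loc_addN.

Lemma loc_mulA : associative loc_mul.
Proof.
move=> x y z; rewrite -[x]reprK -[y]reprK -[z]reprK !piE.
by apply/loc_eqP/frac_equivI => /=; ring.
Qed.

Lemma loc_mulC : commutative loc_mul.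
Proof.
move=> x y; rewrite -[x]reprK -[y]reprK !piE.
by apply/loc_eqP/frac_equivI => /=; ring.
Qed.

Lemma loc_mul1 : left_id loc_one loc_mul.
Proof.
move=> x; rewrite -[x]reprK !piE.
by apply/loc_eqP/frac_equivI => /=; ring.
Qed.

Lemma loc_mulDl : left_distributive loc_mul loc_add.
Proof.
move=> x y z; rewrite -[x]reprK -[y]reprK -[z]reprK !piE.
by apply/loc_eqP/frac_equivI => /=; ring.
Qed.

Lemma loc_one_neq0 : loc_one != loc_zero.
Proof.
rewrite !piE; apply/negP => /asboolP[u /negP up]; rewrite /= !mulr1 subr0 mulr1.
by move=> e; apply: up; rewrite e idealr0.
Qed.

HB.instance Definition _ := GRing.Zmodule_isComNzRing.Build localization
  loc_mulA loc_mulC loc_mul1 loc_mulDl loc_one_neq0.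

End Localization.

(* Serre's condition (S_l), meaningful when R is Noetherian, as is every
   Stanley-Reisner ring below. *)
Definition serre (l : nat) (R : comNzRingType) : Prop :=
  forall p : prime_idealr R,
    ele (emin (Some l) (krull_dim (localization p))) (depth (localization p)).

Record simplicial_complex (T : finType) := SimplicialComplex {
  vertices : {set T};
  faces : {set {set T}};
  face_set0 : set0 \in faces;
  face_sub : forall s t : {set T}, s \in faces -> t \subset s -> t \in faces;
  face_vertices : forall s : {set T}, s \in faces -> s \subset vertices;
  face_set1 : forall v, v \in vertices -> [set v] \in faces
}.

Definition sc_dim (T : finType) (D : simplicial_complex T) : int :=
  (\max_(s in faces D) #|s|)%N%:Z - 1.

Section Induced.
Variables (T : finType) (D : simplicial_complex T) (W : {set T}).

Let ivertices := vertices D :&: W.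
Let ifaces := [set s in faces D | s \subset W].

Lemma induced_set0 : set0 \in ifaces.
Proof. by rewrite inE face_set0 sub0set. Qed.

Lemma induced_sub (s t : {set T}) :
  s \in ifaces -> t \subset s -> t \in ifaces.
Proof.
rewrite !inE => /andP[sD sW] ts.
by rewrite (face_sub sD ts) (subset_trans ts sW).
Qed.

Lemma induced_vertices (s : {set T}) : s \in ifaces -> s \subset ivertices.
Proof. by rewrite inE subsetI => /andP[/face_vertices -> ->]. Qed.

Lemma induced_set1 v : v \in ivertices -> [set v] \in ifaces.
Proof. by rewrite !inE sub1set => /andP[/face_set1 -> ->]. Qed.

Definition induced : simplicial_complex T :=
  SimplicialComplex induced_set0 induced_sub induced_vertices induced_set1.

End Induced.

(* The classes are indexed by 'I_d = {0, ..., d-1} instead of {1, ..., d}. *)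
Definition ordered_partition (T : finType) (V : {set T}) (d : nat)
    (P : 'I_d -> {set T}) : Prop :=
  [/\ forall i, P i != set0,
      forall i j, i != j -> [disjoint P i & P j]
    & \bigcup_i P i = V].

Definition balanced (T : finType) (d : nat) (D : simplicial_complex T)
    (P : 'I_d -> {set T}) : Prop :=
  [/\ sc_dim D = d%:Z - 1,
      ordered_partition (vertices D) P
    & forall (s : {set T}) (i : 'I_d), s \in faces D -> (#|s :&: P i| <= 1)%N].

Definition rank_selected (T : finType) (d : nat) (D : simplicial_complex T)
    (P : 'I_d -> {set T}) (S : {set 'I_d}) : simplicial_complex T :=
  induced D (\bigcup_(i in S) P i).

(* The variable 'X_i of the polynomial ring stands for the vertex [enum_val i]. *)
Section StanleyReisner.
Variables (k : fieldType) (T : finType) (D : simplicial_complex T).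

Definition face_monomial (s : {set T}) : {mpoly k[#|vertices D|]} :=
  \prod_(i < #|vertices D| | enum_val i \in s) 'X_i.

Definition sr_ideal : {pred {mpoly k[#|vertices D|]}} :=
  fun f => `[< ideal_gen (fun g => exists2 s : {set T},
    (s \subset vertices D) && (s \notin faces D) & g = face_monomial s) f >].

Lemma sr_ideal_closed : idealr_closed sr_ideal.
Proof.
split.
- by apply/asboolP; exists 0, (fun=> 0), (fun=> 0); split;
    [case | rewrite big_ord0].
- apply/negP => /asboolP[n [c [g [gP e]]]].
  have /eqP := congr1 (meval (fun=> 0)) e; apply/negP.
  rewrite meval1 raddf_sum big1 /= ?oner_eq0 // => i _; rewrite mevalM.
  have [s /andP[sV sD] ->] := gP i.
  have [v vs] : exists v, v \in s.
    by apply/set0Pn; apply: contraNneq sD => ->; apply: face_set0.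
  have vV := subsetP sV v vs.
  rewrite /face_monomial (bigD1 (enum_rank_in vV v)) ?enum_rankK_in //=.
  by rewrite mevalM mevalXU mul0r mulr0.
- move=> a f h /asboolP[n [c [g [gP ->]]]] /asboolP[m [b [q [qP ->]]]].
  apply/asboolP; exists (n + m)%N.
  exists (fun i => match split i with inl j => a * c j | inr j => b j end).
  exists (fun i => match split i with inl j => g j | inr j => q j end).
  split=> [i|]; first by case: (split i).
  rewrite big_split_ord mulr_sumr /=; congr (_ + _); apply: eq_bigr => i _.
    by rewrite -[lshift m i]/(unsplit (inl i)) unsplitK mulrA.
  by rewrite -[rshift n i]/(unsplit (inr i)) unsplitK.
Qed.

HB.instance Definition _ :=
  isIdealr.Build {mpoly k[#|vertices D|]} sr_ideal sr_ideal_closed.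

Definition sr_ring : comNzRingType := {ideal_quot sr_ideal}.

End StanleyReisner.

(* Main.v *)
Require Import Defs.
From HB Require Import structures.
From mathcomp Require Import all_boot all_order all_algebra.
From mathcomp Require Import boolp.
From mathcomp Require Import mpoly.
From mathcomp Require Import ring zify.

(* Write A = k[Delta], let theta_i be the sum of the variables of colour i, and
   suppose l >= 2 (reduced rings are always (S_1)). The point is that, for balanced
   complexes, (S_l) holds if and only if the theta's of any at most l distinct colours
   form a regular sequence on A. The condition on the theta's descends to Delta_S at
   once, because k[Delta_S] is a retract of A through the map killing the variables
   with colour outside S.

   From (S_l) to the theta's: (S_2) forces purity, since a link whose vertices split
   into two parts not joined by a face gives a local ring of depth at most 1. If
   theta_j is a zero divisor modulo J = (theta_1, ..., theta_(j-1)), choose a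
   homogeneous a outside J with theta_j a in J; some monomial multiple b of a is
   killed modulo J by the prime P_F = (x_v : v not in F) of a face F missing the
   colours 1, ..., j, but by no monomial in the variables of F. By purity A_(P_F) has
   dimension at least j, hence depth at least j, and this contradicts the vanishing
   of the Koszul cohomology of a longer regular sequence.

   From the theta's to (S_l): let p be a prime, F the face of the variables outside
   p and U a maximal subset of F with k[x_U] and p meeting in 0. Each i in F \ U gives
   g_i in p, a polynomial in x_U and x_i whose leading coefficient in x_i is a unit
   at p; the theta's of the colours outside F followed by the g_i form a regular
   sequence at p. It is long enough: for a chain of n primes from p_0 to p, the
   monomials in x_U multiplied by powers of witnesses of the n strict inclusions are
   linearly independent modulo p_0, and counting exponents gives n + |U| <= |F_0| for
   the face F_0 of the variables outside p_0. *)

Set Implicit Arguments.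
Unset Strict Implicit.
Unset Printing Implicit Defensive.

Import GRing.Theory.
Local Open Scope ring_scope.
Local Open Scope quotient_scope.

(** * Ideals and weakly regular sequences *)

Section Ideals.
Variable R : comNzRingType.
Implicit Types (J p : R -> Prop) (s : seq R).

Record is_ideal J : Prop := IsIdeal {
  ideal0 : J 0;
  idealD : forall x y, J x -> J y -> J (x + y);
  idealM : forall a x, J x -> J (a * x) }.

Lemma idealMr J : is_ideal J -> forall a x, J x -> J (x * a).
Proof. by move=> JI a x Jx; rewrite mulrC; apply: idealM. Qed.

Lemma idealN J : is_ideal J -> forall x, J x -> J (- x).
Proof. by move=> JI x Jx; rewrite -mulN1r; apply: idealM. Qed.

Lemma idealB J : is_ideal J -> forall x y, J x -> J y -> J (x - y).
Proof. by move=> JI x y Jx Jy; apply: idealD => //; apply: idealN. Qed.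

Lemma ideal_sum J : is_ideal J -> forall (I : Type) (r : seq I) (P : pred I) (F : I -> R),
  (forall i, P i -> J (F i)) -> J (\sum_(i <- r | P i) F i).
Proof.
by move=> JI I r P F JF; elim/big_ind: _ => //; [exact: ideal0 | exact: idealD].
Qed.

Lemma ideal_subl J : is_ideal J -> forall x y, J (x - y) -> J y -> J x.
Proof. by move=> JI x y Jxy Jy; rewrite -(subrK y x); apply: idealD. Qed.

Record is_prime p : Prop := IsPrime {
  prime_ideal : is_ideal p;
  prime1 : ~ p 1;
  primeM : forall x y, p (x * y) -> p x \/ p y }.

Lemma primeNM p : is_prime p -> forall x y, ~ p x -> ~ p y -> ~ p (x * y).
Proof. by move=> pp x y px py /(primeM pp)[]. Qed.

Lemma primeNX p : is_prime p -> forall x m, ~ p x -> ~ p (x ^+ m).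
Proof.
move=> pp x m px; elim: m => [|m IH]; first by rewrite expr0; apply: prime1.
by rewrite exprS; apply: primeNM.
Qed.

Lemma primeN_prod p : is_prime p -> forall (I : Type) (r : seq I) (P : pred I) (F : I -> R),
  (forall i, P i -> ~ p (F i)) -> ~ p (\prod_(i <- r | P i) F i).
Proof.
move=> pp I r P F pF; apply: (big_ind (fun x => ~ p x)) => //.
- exact: prime1.
- exact: primeNM.
Qed.

(** The ideal J + (g). Adding generators one at a time from the left lets [gen] follow the recursion
    of [wreg]. *)
Definition addi J g : R -> Prop := fun x => exists c, J (x - c * g).

Definition gen J s : R -> Prop := foldl addi J s.

Lemma addi_ideal J g : is_ideal J -> is_ideal (addi J g).
Proof.
move=> JI; split.
- by exists 0; rewrite mul0r subr0; apply: ideal0.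
- move=> x y [c Jc] [e Je]; exists (c + e).
  by rewrite mulrDl opprD addrACA; apply: idealD.
- by move=> a x [c Jc]; exists (a * c); rewrite -mulrA -mulrBr; apply: idealM.
Qed.

Lemma sub_addi J g : is_ideal J -> forall x, J x -> addi J g x.
Proof. by move=> JI x Jx; exists 0; rewrite mul0r subr0. Qed.

Lemma mem_addi J g : is_ideal J -> addi J g g.
Proof. by move=> JI; exists 1; rewrite mul1r subrr; apply: ideal0. Qed.

Lemma addi_min J g L : is_ideal L -> (forall x, J x -> L x) -> L g ->
  forall x, addi J g x -> L x.
Proof.
move=> LI JL Lg x [c /JL]; move/(ideal_subl LI); apply; exact: idealM.
Qed.

Lemma gen_ideal J s : is_ideal J -> is_ideal (gen J s).
Proof. by elim: s J => //= g s IH J JI; apply: IH; apply: addi_ideal. Qed.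

Lemma sub_gen J s : is_ideal J -> forall x, J x -> gen J s x.
Proof.
elim: s J => //= g s IH J JI x Jx; apply: IH; first exact: addi_ideal.
exact: sub_addi.
Qed.

Lemma mem_gen J s : is_ideal J -> forall x, x \in s -> gen J s x.
Proof.
elim: s J => //= g s IH J JI x; rewrite in_cons => /predU1P[->|].
  by apply: sub_gen; [exact: addi_ideal | exact: mem_addi].
by apply: IH; apply: addi_ideal.
Qed.

Lemma gen_min J s L : is_ideal L -> (forall x, J x -> L x) ->
  (forall x, x \in s -> L x) -> forall x, gen J s x -> L x.
Proof.
move=> LI; elim: s J => //= g s IH J JL sL; apply: IH.
  by apply: addi_min => //; apply: sL; rewrite mem_head.
by move=> x xs; apply: sL; rewrite in_cons xs orbT.
Qed.

(* Weakly regular sequences on R/J: properness of the ideal is not asked for. *)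
Fixpoint wreg J s : Prop :=
  if s is g :: s' then (forall a, J (g * a) -> J a) /\ wreg (addi J g) s'
  else True.

Lemma wreg_cat J s t : wreg J (s ++ t) <-> wreg J s /\ wreg (gen J s) t.
Proof.
elim: s J => [|g s IH] J /=; first by split=> // -[].
by rewrite IH; tauto.
Qed.

Lemma wreg_rcons J s g :
  wreg J (rcons s g) <-> wreg J s /\ (forall a, gen J s (g * a) -> gen J s a).
Proof. by rewrite -cats1 wreg_cat /=; tauto. Qed.

End Ideals.

(** * Koszul cohomology *)

Section Koszul.
Variable R : comNzRingType.
Implicit Types (J : R -> Prop) (x y : seq R) (f g : bitseq -> R) (b : bitseq).

(* A cochain of the Koszul complex of y is a function on bit sequences of
   length size y, read as subsets of y; the number of bits set is the degree. *)
Fixpoint koszul y f b : R :=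
  match y, b with
  | z :: y', false :: b' => koszul y' (fun e => f (false :: e)) b'
  | z :: y', true :: b' =>
      z * f (false :: b') - koszul y' (fun e => f (true :: e)) b'
  | _, _ => 0
  end.

Definition cell y i b := (size b == size y) && (count id b == i).

Lemma koszulB y f g b :
  koszul y (fun e => f e - g e) b = koszul y f b - koszul y g b.
Proof. elim: y f g b => [|z y IH] f g [|[] b] //=; rewrite ?IH; ring. Qed.

Lemma koszulZ y a f b : koszul y (fun e => a * f e) b = a * koszul y f b.
Proof. elim: y f b => [|z y IH] f [|[] b] //=; rewrite ?IH; ring. Qed.

Lemma koszulN y f b : koszul y (fun e => - f e) b = - koszul y f b.
Proof. elim: y f b => [|z y IH] f [|[] b] //=; rewrite ?IH; ring. Qed.

Lemma koszul_koszul y f b : koszul y (koszul y f) b = 0.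
Proof.
elim: y f b => [|z y IH] f [|[] b] //=.
by rewrite koszulB koszulZ IH subr0 subrr.
Qed.

Lemma koszul_cell0 y f b : cell y 0 b -> koszul y f b = 0.
Proof.
elim: y f b => [|z y IH] f [|[] b] //; first by rewrite /cell /= add1n andbF.
by move=> cb; apply: IH.
Qed.

Lemma koszul_ideal J y i f : is_ideal J ->
  (forall b, cell y i b -> J (f b)) -> forall b, cell y i.+1 b -> J (koszul y f b).
Proof.
move=> JI; elim: y f i => [|z y IH] f i Jf [|[] b] //=; try by move=> _; exact: ideal0.
- move=> cb; apply: idealB => //.
    by apply: idealM => //; apply: Jf; rewrite /cell /= in cb *; lia.
  case: i Jf cb => [|i] Jf cb.
    rewrite koszul_cell0; first exact: ideal0.
    by rewrite /cell /= in cb *; lia.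
  apply: (IH _ i) => [e ce|]; last by rewrite /cell /= in cb *; lia.
  by apply: Jf; rewrite /cell /= in ce *; lia.
- move=> cb; apply: (IH _ i) => [e ce|]; last by rewrite /cell /= in cb *; lia.
  by apply: Jf; rewrite /cell /= in ce *; lia.
Qed.

(** Vanishing of the i-th Koszul cohomology of y on R/J. For i = 0 coboundaries are zero, so the
    condition makes f itself vanish modulo J in degree 0. *)
Definition kexact J y i := forall f,
  (forall b, cell y i.+1 b -> J (koszul y f b)) ->
  exists g, forall b, cell y i b -> J (f b - koszul y g b).

(** Long exact sequence of 0 -> R/J -> R/J -> R/(J + (u)) -> 0, the first map being multiplication
    by u: the i-th cohomology of the last term sits between the i-th and the (i+1)-st of R/J. *)
Lemma kexact_addi J y i u : is_ideal J -> (forall a, J (u * a) -> J a) ->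
  kexact J y i -> kexact J y i.+1 -> kexact (addi J u) y i.
Proof.
move=> JI Ju ex_i ex_i1 f Jf.
have [c Jc] : exists c, forall b, cell y i.+1 b -> J (koszul y f b - c b * u).
  have [|c Jc] := @choice _ _
    (fun b c => cell y i.+1 b -> J (koszul y f b - c * u)); last by exists c.
  move=> b; case: (boolP (cell y i.+1 b)) => [/Jf[c Jc]|_]; last by exists 0.
  by exists c.
have [g Jg] : exists g, forall b, cell y i.+1 b -> J (c b - koszul y g b).
  apply: ex_i1 => b cb; apply: Ju.
  have := koszul_ideal (f := fun b => koszul y f b - u * c b) JI _ cb.
  rewrite koszulB koszulZ koszul_koszul sub0r => Jd.
  rewrite -[u * _]opprK; apply: idealN => //; apply: Jd => e ce.
  by rewrite mulrC; apply: Jc.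
have [|h Jh] := ex_i (fun b => f b - u * g b); last first.
  exists h => b cb; exists (g b).
  by have := Jh b cb; rewrite (mulrC u) addrAC.
move=> b cb; rewrite koszulB koszulZ.
have -> : koszul y f b - u * koszul y g b =
  (koszul y f b - c b * u) + u * (c b - koszul y g b) by ring.
by apply: idealD => //; [apply: Jc | apply: idealM => //; apply: Jg].
Qed.

(** Induction on y. The part of a cocycle f on the sets containing z is a cocycle modulo J + (z),
    hence the coboundary of some g1 up to a multiple z * h. The cochain made of h and - g1 then
    bounds f; on the sets without z this is checked after multiplying by z. *)
Lemma wreg_kexact J y i : is_ideal J -> wreg J y -> (i < size y)%N -> kexact J y i.
Proof.
elim: y J i => // z y IH J i JI [Jz Jy] iy f Jf.
have cF e k : cell y k e -> cell (z :: y) k (false :: e) by rewrite /cell /=; lia.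
have cT e k : cell y k e -> cell (z :: y) k.+1 (true :: e) by rewrite /cell /=; lia.
case: i iy Jf => [|i] iy Jf.
  exists (fun=> 0) => b cb; rewrite koszul_cell0 // subr0.
  case: b cb => [|[] b]; rewrite /cell //= => cb; first by lia.
  apply: Jz; have := Jf (true :: b); rewrite /= koszul_cell0 ?subr0 /cell /=; last by lia.
  by apply; lia.
have [g1 Jg1] : exists g1, forall e, cell y i e ->
    addi J z (f (true :: e) - koszul y g1 e).
  apply: (IH _ i _ _ _ (fun e => f (true :: e))) => //; first exact: addi_ideal.
  move=> e ce; exists (f (false :: e)); rewrite -opprB mulrC.
  by apply: idealN => //; apply: (Jf (true :: e)); apply: cT.
have [h Jh] : exists h, forall e, cell y i e ->
    J (f (true :: e) - koszul y g1 e - h e * z).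
  have [|h Jh] := @choice _ _ (fun e c => cell y i e ->
    J (f (true :: e) - koszul y g1 e - c * z)); last by exists h.
  move=> e; case: (boolP (cell y i e)) => [/Jg1[c Jc]|_]; last by exists 0.
  by exists c.
exists (fun e => if e is c :: e' then if c then - g1 e' else h e' else 0).
case=> [|[] b] cb /=; first by rewrite /cell /= in cb; lia.
  rewrite koszulN.
  have -> : f (true :: b) - (z * h b - - koszul y g1 b)
    = f (true :: b) - koszul y g1 b - h b * z by ring.
  by apply: Jh; rewrite /cell /= in cb *; lia.
have cb' : cell y i.+1 b by rewrite /cell /= in cb *; lia.
apply: Jz; have := Jf (true :: b) (cT _ _ cb'); rewrite /= => Jb.
have := koszul_ideal
  (f := fun e => f (true :: e) - koszul y g1 e - z * h e) JI _ cb'.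
rewrite !koszulB koszulZ koszul_koszul => Jk.
have -> : z * (f (false :: b) - koszul y h b) =
  z * f (false :: b) - koszul y (fun e => f (true :: e)) b +
  (koszul y (fun e => f (true :: e)) b - 0 - z * koszul y h b) by ring.
apply: idealD => //; apply: Jk => e ce.
by rewrite (mulrC z); apply: Jh.
Qed.

Lemma kexact_gen J x y : is_ideal J -> wreg J x ->
  (forall i, (i <= size x)%N -> kexact J y i) -> kexact (gen J x) y 0.
Proof.
elim: x J => [|u x IH] J JI /=; first by move=> _; apply.
move=> [Ju Jx] ex; apply: IH => //; first exact: addi_ideal.
by move=> i ix; apply: kexact_addi => //; apply: ex; lia.
Qed.

(** An element c killed by y is a 0-cocycle of the Koszul complex of y. Each element of x costs one
    degree of vanishing, and y has enough degrees to leave degree 0. *)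
Lemma wreg_colon_gen J x y c : is_ideal J -> wreg J x -> wreg J y ->
  (size x < size y)%N -> (forall z, z \in y -> gen J x (z * c)) -> gen J x c.
Proof.
move=> JI Jx Jy xy Jc; have GI := gen_ideal x JI.
have [|b cb|g Jg] := @kexact_gen J x y JI Jx _ (fun=> c).
- by move=> i ix; apply: wreg_kexact => //; lia.
- have : forall z, z \in y -> gen J x (z * c) by [].
  move: (gen J x) GI => L LI {Jc Jx Jy xy}.
  elim: y b cb => [|z y IH] [|[] b] cb Lc //=; try exact: ideal0.
    apply: idealB => //; first by apply: Lc; rewrite mem_head.
    rewrite koszul_cell0; first exact: ideal0.
    by rewrite /cell /= in cb *; lia.
  apply: IH => [|w wy]; first by rewrite /cell /= in cb *; lia.
  by apply: Lc; rewrite in_cons wy orbT.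
- have cb : cell y 0 (nseq (size y) false).
    by rewrite /cell size_nseq eqxx count_nseq mul0n.
  by have := Jg _ cb; rewrite koszul_cell0 // subr0.
Qed.

End Koszul.

(** * Depth and dimension of localizations *)

(** The witness m excludes the empty set, whose supremum is 0 by convention. *)
Lemma ele_esup (A : nat -> Prop) (m n : nat) : A m ->
  ele (Some n) (esup A) <-> exists2 N, (n <= N)%N & A N.
Proof.
move=> Am; rewrite /esup; case: pselect => [bd|unbd] /=; last first.
  split=> // _; apply: contrapT => nA; apply: unbd; exists n.
  apply/asboolP => N AN; case: leqP => // nN; case: nA; exists N => //; exact: ltnW.
case: ex_minnP => M /asboolP AM minM; split=> [nM|[N nN /AM]]; last exact: leq_trans.
suff AMM : A M by exists M.
apply: contrapT => nAM.
have ltM N : A N -> (N < M)%N.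
  by move=> AN; rewrite ltn_neqAle AM // andbT; apply: contra_notN nAM => /eqP <-.
have := ltM _ Am; case: M {AM nM nAM} minM ltM => // M minM ltM _.
have := minM M; rewrite ltnn => h; suff : false by [].
by apply: h; apply/asboolP => N /ltM; rewrite ltnS.
Qed.

Lemma ele_emin (l : nat) (x y : enat) :
  ele (emin (Some l) x) y <->
  (forall n, (n <= l)%N -> ele (Some n) x -> ele (Some n) y).
Proof.
case: y => [y|]; last by split=> // _; case: (emin _ _).
case: x => [x|] /=; last first.
  by split=> [ly n nl _|/(_ l (leqnn l) isT)] //; apply: leq_trans ly.
rewrite /emin /=; split=> [|h].
  by case: ifP => _ /= h n nl nx; [apply: leq_trans nl h | apply: leq_trans nx h].
case: ifP => lx /=; first exact: h.
by apply: h => //; move/negbT: lx; rewrite -ltnNge => /ltnW.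
Qed.

Section PrimeChains.
Variable Q : comNzRingType.
Implicit Types (I p J : Q -> Prop) (s : seq Q).

(** Such a chain exists exactly when the localization of Q/I at p has dimension at least n. *)
Definition pchain I p n := exists q : nat -> Q -> Prop,
  [/\ forall i, (i <= n)%N -> is_prime (q i),
      forall i, (i < n)%N -> (forall a, q i a -> q i.+1 a)
        /\ exists2 a, q i.+1 a & ~ q i a,
      forall a, I a -> q 0 a
    & forall a, q n a -> p a].

(* The images of s in the localization of Q/J at p form a weakly regular
   sequence. *)
Fixpoint wregl p J s : Prop :=
  if s is g :: s' then
    (forall a, J (g * a) -> exists2 u, ~ p u & J (u * a))
    /\ wregl p (addi J g) s'
  else True.

Lemma wregl_cat p J s t : wregl p J (s ++ t) <-> wregl p J s /\ wregl p (gen J s) t.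
Proof.
elim: s J => [|g s IH] J /=; first by split=> // -[].
by rewrite IH; tauto.
Qed.

Lemma wregl_take p J s m : wregl p J s -> wregl p J (take m s).
Proof. by rewrite -{1}(cat_take_drop m s) wregl_cat => -[]. Qed.

Lemma wreg_wregl p J s : is_prime p -> wreg J s -> wregl p J s.
Proof.
move=> pp; elim: s J => //= g s IH J [Jg Js]; split; last exact: IH.
by move=> a /Jg Ja; exists 1; [exact: prime1 | rewrite mul1r].
Qed.

(** Serre's condition for Q/I, stated with elements and primes of Q. Quantifying over n <= l
    replaces the minimum of l and the dimension, and avoids infinite values. *)
Definition serre_ideal (l : nat) I := forall p, is_prime p -> (forall a, I a -> p a) ->
  forall n, (n <= l)%N -> pchain I p n ->
  exists s, [/\ size s = n, forall x, x \in s -> p x & wregl p I s].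

End PrimeChains.

Section PrimeOf.
Variables (R : comNzRingType) (q : R -> Prop) (qp : is_prime q).

Definition prime_pred : R -> bool := fun x => `[< q x >].

Lemma prime_pred_idealr : idealr_closed prime_pred.
Proof.
have qI := prime_ideal qp; split.
- by apply/asboolP; apply: ideal0.
- by apply/asboolP; apply: prime1.
- move=> a x y /asboolP qx /asboolP qy; apply/asboolP.
  by apply: idealD => //; apply: idealM.
Qed.

Lemma prime_pred_prime : prime_idealr_closed prime_pred.
Proof.
by move=> x y /asboolP/(primeM qp)[h|h]; apply/orP; [left|right]; apply/asboolP.
Qed.

HB.instance Definition _ := isIdealr.Build R prime_pred prime_pred_idealr.
HB.instance Definition _ := isPrimeIdealrClosed.Build R prime_pred prime_pred_prime.

Definition prime_of : prime_idealr R := prime_pred.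

Lemma prime_ofP x : (x \in prime_of) <-> q x.
Proof. by split=> [/asboolP|qx] //; apply/asboolP. Qed.

End PrimeOf.

Lemma prime_idealr_is_prime (R : comNzRingType) (q : prime_idealr R) :
  is_prime (fun x => x \in q).
Proof.
split.
- split=> [|x y|a x]; [exact: idealr0 | exact: rpredD | exact: ring_quotient.idealMr].
- by rewrite idealr1.
- by move=> x y; rewrite prime_idealrM => /orP.
Qed.

Lemma prime_preimage (Q R : comNzRingType) (f : {rmorphism Q -> R}) (q : prime_idealr R) :
  is_prime (fun a => f a \in q).
Proof.
have [[q0 qD qM] q1 qP] := prime_idealr_is_prime q.
split; first split=> [|x y|a x]; rewrite ?rmorph0 ?rmorphD ?rmorphM.
- exact: q0.
- exact: qD.
- exact: qM.
- by rewrite rmorph1.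
- by move=> x y; rewrite rmorphM; apply: qP.
Qed.

Section Loc.
Variables (Q L : comNzRingType) (I p : Q -> Prop) (phi : {rmorphism Q -> L}).

(** These properties characterize L as the localization of Q/I at p. They are used for the kernel I
    of a surjection onto a Stanley-Reisner ring and for I = 0. *)
Record is_loc : Prop := IsLoc {
  loc_eq0 : forall a, phi a = 0 <-> exists2 u, ~ p u & I (u * a);
  loc_frac : forall y, exists t a, ~ p t /\ phi t * y = phi a;
  loc_unit : forall t, ~ p t -> exists z, phi t * z = 1 }.

Hypotheses (pp : is_prime p) (Ip : forall a, I a -> p a) (ph : is_loc).

Lemma loc_ker_sub a : phi a = 0 -> p a.
Proof. by move=> /(loc_eq0 ph)[u pu /Ip /(primeM pp)[]]. Qed.

Lemma loc_nonunit t a y : ~ p t -> phi t * y = phi a -> nonunit y <-> p a.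
Proof.
move=> pt e; split=> [ny|pa [z yz]].
  apply: contrapT => /(loc_unit ph)[z az]; apply: ny; exists (phi t * z).
  by rewrite mulrA (mulrC y) e.
have [s [b [ps sb]]] := loc_frac ph z.
have : p (t * s - a * b).
  apply: loc_ker_sub; rewrite rmorphB !rmorphM -e -sb.
  have -> : phi t * phi s - phi t * y * (phi s * z) =
    phi t * phi s * (1 - y * z) by ring.
  by rewrite yz subrr mulr0.
move/(ideal_subl (prime_ideal pp)) => h; apply: (primeNM pp pt ps); apply: h.
by apply: idealMr => //; apply: prime_ideal.
Qed.

Lemma nonunit_prime : is_prime (fun y : L => nonunit y).
Proof.
have pI := prime_ideal pp; split; first split.
- by case=> y; rewrite mul0r => /eqP; rewrite eq_sym oner_eq0.
- move=> x y; have [t [a [pt e]]] := loc_frac ph x.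
  have [s [b [ps f]]] := loc_frac ph y.
  rewrite (loc_nonunit pt e) (loc_nonunit ps f) => pa pb.
  apply/(@loc_nonunit (t * s) (s * a + t * b)); first exact: primeNM.
    by rewrite rmorphD !rmorphM -e -f; ring.
  by apply: idealD => //; apply: idealM.
- by move=> a x nx [y xy]; apply: nx; exists (a * y); rewrite mulrA (mulrC x).
- by apply; exists 1; rewrite mulr1.
- move=> x y; have [t [a [pt e]]] := loc_frac ph x.
  have [s [b [ps f]]] := loc_frac ph y.
  rewrite (loc_nonunit pt e) (loc_nonunit ps f).
  have -> := @loc_nonunit (t * s) (a * b) (x * y); first exact: primeM.
    exact: primeNM.
  by rewrite !rmorphM -e -f; ring.
Qed.

(** The preimage of J in Q is the saturation of JQ at p, so J is the extension of JQ. *)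
Definition loc_sat (J : L -> Prop) (JQ : Q -> Prop) :=
  forall a, J (phi a) <-> exists2 u, ~ p u & JQ (u * a).

Lemma loc_cancel (J : L -> Prop) t y : is_ideal J -> ~ p t -> J (phi t * y) -> J y.
Proof.
move=> JI /(loc_unit ph)[z tz] Jy.
have -> : y = z * (phi t * y) by rewrite mulrA (mulrC z) tz mul1r.
exact: idealM.
Qed.

Lemma loc_sat_addi J JQ t a y : is_ideal J -> is_ideal JQ -> loc_sat J JQ ->
  ~ p t -> phi t * y = phi a -> loc_sat (addi J y) (addi JQ a).
Proof.
move=> JI JQI sat pt e b; split=> [[c Jc]|[u pu [c Jc]]].
  have [s [d [ps sd]]] := loc_frac ph c.
  have /sat[u pu Ju] : J (phi (t * s * b - d * a)).
    rewrite rmorphB !rmorphM -e -sd.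
    have -> : phi t * phi s * phi b - phi s * c * (phi t * y) =
      phi t * phi s * (phi b - c * y) by ring.
    exact: idealM.
  exists (u * (t * s)); first by do !apply: primeNM.
  by exists (u * d); move: Ju; rewrite mulrBr !mulrA.
apply: (loc_cancel (addi_ideal y JI) pu); exists (phi c * phi t).
rewrite -mulrA e -!rmorphM -rmorphB; apply/sat; exists 1; first exact: prime1.
by rewrite mul1r.
Qed.

Lemma wreg_wregl_lift (J : L -> Prop) (JQ : Q -> Prop) (s : seq L) :
  is_ideal J -> is_ideal JQ -> loc_sat J JQ -> (forall y, y \in s -> nonunit y) ->
  wreg J s ->
  exists r, [/\ size r = size s, forall x, x \in r -> p x & wregl p JQ r].
Proof.
elim: s J JQ => [|y s IH] J JQ JI JQI sat nu; first by exists [::].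
move=> [Jy Js]; have [t [a [pt e]]] := loc_frac ph y.
have [] := IH _ _ (addi_ideal y JI) (addi_ideal a JQI)
  (loc_sat_addi JI JQI sat pt e) _ Js.
  by move=> z zs; apply: nu; rewrite in_cons zs orbT.
move=> r [sr pr rr]; exists (a :: r); split=> /=.
- by rewrite sr.
- move=> x; rewrite in_cons => /predU1P[->|/pr] //.
  by apply/(loc_nonunit pt e); apply: nu; rewrite mem_head.
- split=> // b Jb; apply/sat/Jy/(loc_cancel JI pt).
  rewrite mulrA e -rmorphM; apply/sat; exists 1; first exact: prime1.
  by rewrite mul1r.
Qed.

Lemma wregl_wreg_map (J : L -> Prop) (JQ : Q -> Prop) (r : seq Q) :
  is_ideal J -> is_ideal JQ -> loc_sat J JQ -> wregl p JQ r -> wreg J (map phi r).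
Proof.
elim: r J JQ => [|a r IH] J JQ JI JQI sat //= [Ja Jr]; split.
  move=> y Jy; have [t [b [pt e]]] := loc_frac ph y.
  apply: (loc_cancel JI pt); rewrite e; apply/sat.
  have /sat[u pu] : J (phi (a * b)).
    by rewrite rmorphM -e mulrCA; apply: idealM.
  rewrite mulrCA => /Ja[v pv Jv]; exists (v * u); first exact: primeNM.
  by rewrite -mulrA.
apply: (IH _ (addi JQ a)) => //; try exact: addi_ideal.
apply: (@loc_sat_addi _ _ 1) => //; first exact: prime1.
by rewrite rmorph1 mul1r.
Qed.

Lemma loc_sat_gen J JQ r : is_ideal J -> is_ideal JQ -> loc_sat J JQ ->
  loc_sat (gen J (map phi r)) (gen JQ r).
Proof.
elim: r J JQ => [|a r IH] J JQ JI JQI sat //=.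
apply: IH; try exact: addi_ideal.
apply: (@loc_sat_addi _ _ 1) => //; first exact: prime1.
by rewrite rmorph1 mul1r.
Qed.

Let zero (x : L) := x = 0.

Lemma zero_ideal : is_ideal zero.
Proof. by split=> [|x y -> ->|a x ->]; rewrite /zero ?addr0 ?mulr0. Qed.

Lemma ideal_seq_gen (s : seq L) x : ideal_seq s x <-> gen zero s x.
Proof.
have GI := gen_ideal s zero_ideal; split=> [[n [c [g [gs ->]]]]|].
  apply: ideal_sum => // i _; apply: idealM => //; apply: mem_gen => //.
  exact: zero_ideal.
apply: gen_min => [|y ->|y ys].
- split.
  + by exists 0, (fun=> 0), (fun=> 0); split=> [[]//|]; rewrite big_ord0.
  + move=> _ _ [n [c [g [gs ->]]]] [m [d [h [hs ->]]]]; exists (n + m)%N.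
    exists (fun i => match split i with inl j => c j | inr j => d j end).
    exists (fun i => match split i with inl j => g j | inr j => h j end).
    split=> [i|]; first by case: (split i).
    rewrite big_split_ord /=; congr (_ + _); apply: eq_bigr => i _.
      by rewrite -[lshift m i]/(unsplit (inl i)) unsplitK.
    by rewrite -[rshift n i]/(unsplit (inr i)) unsplitK.
  + move=> a _ [n [c [g [gs ->]]]]; exists n, (fun i => a * c i), g; split=> //.
    by rewrite mulr_sumr; apply: eq_bigr => i _; rewrite mulrA.
- by exists 0, (fun=> 0), (fun=> 0); split=> [[]//|]; rewrite big_ord0.
- by exists 1, (fun=> 1), (fun=> y); split=> //; rewrite big_ord1 mul1r.
Qed.

Lemma wregP (s : seq L) : wreg zero s <-> forall i, (i < size s)%N ->
  forall a, ideal_seq (take i s) (s`_i * a) -> ideal_seq (take i s) a.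
Proof.
elim/last_ind: s => [|s g IH]; first by split.
rewrite wreg_rcons IH; split=> [[hs hg] i|h]; last first.
  split=> [i si a|a].
    have := h i _ a; rewrite size_rcons ltnS => /(_ (ltnW si)).
    by rewrite nth_rcons si -cats1 takel_cat // ltnW.
  have := h (size s) _ a; rewrite size_rcons ltnSn => /(_ isT).
  by rewrite nth_rcons ltnn eqxx -cats1 take_size_cat // !ideal_seq_gen.
rewrite size_rcons ltnS leq_eqVlt => /predU1P[->|si] a.
  by rewrite nth_rcons ltnn eqxx -cats1 take_size_cat // !ideal_seq_gen; apply: hg.
by rewrite nth_rcons si -cats1 takel_cat 1?ltnW //; apply: hs.
Qed.

(** Properness comes for free: the nonunits of L form a proper ideal containing s. *)
Lemma regular_seq_wreg (s : seq L) : (forall x, x \in s -> nonunit x) ->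
  regular_seq s <-> wreg zero s.
Proof.
move=> nu; rewrite wregP; split=> [[]//|h]; split=> //.
rewrite ideal_seq_gen => g1.
have : nonunit (1 : L).
  move: g1; apply: gen_min => //; first exact: prime_ideal nonunit_prime.
  by move=> x ->; apply: ideal0 (prime_ideal nonunit_prime).
by apply; exists 1; rewrite mulr1.
Qed.

Hypothesis II : is_ideal I.

Lemma loc_sat0 : loc_sat zero I.
Proof. exact: loc_eq0 ph. Qed.

(** Denominators are units of L, so a regular sequence can be cleared of them and lifted to p;
    longer sequences are truncated to length n. *)
Lemma depthP n : ele (Some n) (depth L) <->
  exists s, [/\ size s = n, forall x, x \in s -> p x & wregl p I s].
Proof.
have nounit x : p x -> nonunit (phi x).
  move=> px; apply/(@loc_nonunit 1 x) => //; first exact: prime1.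
  by rewrite rmorph1 mul1r.
rewrite /depth (@ele_esup _ 0); last first.
  exists [::]; split=> //; apply/regular_seq_wreg => //.
split=> [[N nN [s [sN nu /regular_seq_wreg-/(_ nu) rs]]]|[s [sn ps rs]]].
  have [r [sr pr rr]] := wreg_wregl_lift zero_ideal II loc_sat0 nu rs.
  exists (take n r); split; first by rewrite size_takel // sr sN.
    by move=> x /mem_take /pr.
  exact: wregl_take.
exists n => //; exists (map phi s); rewrite size_map; split=> //.
  by move=> _ /mapP[x xs ->]; apply/nounit/ps.
apply/regular_seq_wreg; first by move=> _ /mapP[x xs ->]; apply/nounit/ps.
by apply: wregl_wreg_map rs => //; [exact: zero_ideal | exact: loc_sat0].
Qed.

Lemma krull_dimP n : ele (Some n) (krull_dim L) <-> pchain I p n.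
Proof.
have pr0 := nonunit_prime.
rewrite /krull_dim (@ele_esup _ 0); last by exists (fun=> prime_of pr0).
split=> [[N nN [P cP]]|[q [qp qs Iq qn]]].
  exists (fun i a => phi a \in P i); split.
  - by move=> i _; apply: prime_preimage.
  - move=> i si; have [sub nsub] := cP i (leq_trans si nN).
    split=> [a|]; first exact: sub.
    apply: contrapT => no; apply: nsub => y Py.
    have [t [a [pt e]]] := loc_frac ph y.
    have : phi a \in P i.
      apply: contrapT => na; apply: no; exists a => //.
      by rewrite -e ring_quotient.idealMr.
    rewrite -e prime_idealrM => /orP[|//].
    have [z tz] := loc_unit ph pt; move=> /(ring_quotient.idealMr z).
    by rewrite mulrC tz idealr1.
  - move=> a Ia; suff -> : phi a = 0 by apply: idealr0.
    by apply/(loc_eq0 ph); exists 1; [exact: prime1 | rewrite mul1r].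
  - move=> a Pa; apply: contrapT => /(loc_unit ph)[z az].
    by move: Pa => /(ring_quotient.idealMr z); rewrite mulrC az idealr1.
have qmono i j : (i <= j <= n)%N -> forall a, q i a -> q j a.
  move=> /andP[]; elim: j => [|j IH]; first by rewrite leqn0 => /eqP ->.
  rewrite leq_eqVlt => /predU1P[->//|ij] jn a /IH qa.
  by apply: (qs j jn).1; apply: qa => //; apply: ltnW.
have qIp i : (i <= n)%N -> forall a, q i a -> p a.
  by move=> i_n a qa; apply: qn; apply: qmono qa; rewrite i_n leqnn.
have Iqi i : (i <= n)%N -> forall a, I a -> q i a.
  by move=> i_n a /Iq; apply: qmono; rewrite i_n.
(* The extension of q i to L: the fractions that have some numerator in q i. *)
pose qL i (y : L) := exists t a, [/\ ~ p t, phi t * y = phi a & q i a].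
have qLP i a : (i <= n)%N -> qL i (phi a) <-> q i a.
  move=> i_n; split=> [[t [b [pt e qb]]]|qa]; last first.
    by exists 1, a; rewrite rmorph1 mul1r; split=> //; apply: prime1.
  have : phi (t * a - b) = 0 by rewrite rmorphB rmorphM e subrr.
  move=> /(loc_eq0 ph)[u pu /(Iqi _ i_n)].
  have qi := qp i i_n; move=> /(primeM qi)[/(qIp _ i_n)//|].
  move=> /(ideal_subl (prime_ideal qi))/(_ qb) /(primeM qi)[/(qIp _ i_n)//|//].
have qLp i : (i <= n)%N -> is_prime (qL i).
  move=> i_n; have qi := qp i i_n; have qI := prime_ideal qi; split; first split.
  - by exists 1, 0; rewrite !rmorph0 mulr0; split=> //; [exact: prime1 | exact: ideal0].
  - move=> x y [t [a [pt e qa]]] [s [b [ps f qb]]]; exists (t * s), (s * a + t * b).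
    split; first exact: primeNM.
      by rewrite rmorphD !rmorphM -e -f; ring.
    by apply: idealD => //; apply: idealM.
  - move=> x y [t [a [pt e qa]]]; have [s [b [ps f]]] := loc_frac ph x.
    exists (s * t), (b * a); split; first exact: primeNM.
      by rewrite !rmorphM -e -f; ring.
    exact: idealM.
  - by rewrite -(rmorph1 phi) qLP //; apply: prime1.
  - move=> x y [t [a [pt e qa]]].
    have [s [b [ps f]]] := loc_frac ph x; have [r [c [pr g]]] := loc_frac ph y.
    have : qL i (phi (b * c)).
      exists t, (s * r * a); split=> //; last exact: idealM.
      by rewrite !rmorphM -e -f -g; ring.
    rewrite qLP // => /(primeM qi)[qb|qc]; [left; exists s, b | right; exists r, c];
    by split.
(* A chain is indexed by all of nat, but q i is known to be prime only for i <= n; hence the capped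
   index. *)
have mn i : (minn i n <= n)%N by rewrite geq_minr.
exists n => //; exists (fun i => prime_of (qLp _ (mn i))) => i si.
have -> : prime_of (qLp _ (mn i)) = prime_of (qLp _ (ltnW si)).
  move: (mn i); rewrite (minn_idPl (ltnW si)) => h.
  by congr (prime_of (qLp _ _)); apply: bool_irrelevance.
have -> : prime_of (qLp _ (mn i.+1)) = prime_of (qLp _ si).
  move: (mn i.+1); rewrite (minn_idPl si) => h.
  by congr (prime_of (qLp _ _)); apply: bool_irrelevance.
have [sub [a qa nqa]] := qs i si; split.
  move=> y /prime_ofP[t [b [pt e qb]]]; apply/prime_ofP.
  by exists t, b; split=> //; apply: sub.
move=> /(_ (phi a)); rewrite !prime_ofP !qLP //; last exact: ltnW.
by move=> /(_ qa).
Qed.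

End Loc.

Section LocMap.
Variables (R : comNzRingType) (p : prime_idealr R).

Definition loc_map (r : R) : localization p := \pi_(localization p) (r, denom1 p).

Lemma loc_map_is_zmod : zmod_morphism loc_map.
Proof.
move=> x y; rewrite /loc_map.
have -> : - \pi_(localization p) (y, denom1 p) = \pi_(localization p) (- y, denom1 p).
  by rewrite [LHS](esym (pi_loc_opp _)).
rewrite [RHS](esym (pi_loc_add _ _)).
by apply/loc_eqP/frac_equivI => /=; ring.
Qed.

Lemma loc_map_is_monoid : monoid_morphism loc_map.
Proof.
split; first by apply/esym; rewrite -[LHS]/(loc_one p) [LHS]piE.
move=> x y; rewrite /loc_map [RHS](esym (pi_loc_mul _ _)).
by apply/loc_eqP/frac_equivI => /=; ring.
Qed.

HB.instance Definition _ := GRing.isZmodMorphism.Build R (localization p)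
  loc_map loc_map_is_zmod.
HB.instance Definition _ := GRing.isMonoidMorphism.Build R (localization p)
  loc_map loc_map_is_monoid.

Lemma is_loc_loc_map (Q : comNzRingType) (I : Q -> Prop) (f : {rmorphism Q -> R}) :
  (forall y, exists a, f a = y) -> (forall a, f a = 0 <-> I a) ->
  is_loc I (fun a => f a \in p) (loc_map \o f).
Proof.
move=> fS fI; split=> [a|y|t pt] /=.
- rewrite -[0](rmorph0 loc_map); split=> [/loc_eqP/asboolP[v pv]|[u pu /fI]].
    rewrite /= !mulr1 subr0 => va; have [u uv] := fS v; exists u.
      by rewrite uv; apply/negP.
    by apply/fI; rewrite rmorphM uv.
  rewrite rmorphM => ua; apply/loc_eqP/asboolP; exists (f u); first exact/negP.
  by rewrite /= !mulr1 subr0.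
- rewrite -[y]reprK; case: (repr y) => b [s ps].
  have [t ts] := fS s; have [a ab] := fS b; exists t, a; rewrite ts ab.
  split; first exact/negP.
  rewrite /loc_map [LHS](esym (pi_loc_mul _ _)).
  by apply/loc_eqP/frac_equivI => /=; ring.
- move/negP: pt => pt; pose s : denom p := exist (fun s => s \notin p) (f t) pt.
  exists (\pi_(localization p) (1, s)).
  rewrite /loc_map [LHS](esym (pi_loc_mul _ _)) -(rmorph1 loc_map).
  by apply/loc_eqP/frac_equivI => /=; ring.
Qed.

End LocMap.

(** Primes of R correspond under f to the primes of Q containing I, the kernel of f. *)
Lemma serreP (Q R : comNzRingType) (I : Q -> Prop) (f : {rmorphism Q -> R}) (l : nat) :
  is_ideal I -> (forall y, exists a, f a = y) -> (forall a, f a = 0 <-> I a) ->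
  serre l R <-> serre_ideal l I.
Proof.
move=> II fS fI.
have fprime (P : prime_idealr R) := prime_preimage f P.
have Isub (P : prime_idealr R) a : I a -> f a \in P by move/fI ->; apply: idealr0.
have key (P : prime_idealr R) :
    ele (emin (Some l) (krull_dim (localization P))) (depth (localization P)) <->
    forall n, (n <= l)%N -> pchain I (fun a => f a \in P) n ->
    exists s, [/\ size s = n, forall x, x \in s -> f x \in P
      & wregl (fun a => f a \in P) I s].
  have ph := is_loc_loc_map P fS fI.
  rewrite ele_emin; split=> h n nl.
    by move/(krull_dimP (fprime P) (Isub P) ph)/(h n nl)/(depthP (fprime P) (Isub P) ph II).
  by move/(krull_dimP (fprime P) (Isub P) ph)/(h n nl)/(depthP (fprime P) (Isub P) ph II).
split=> [h p pp Ip|h P]; last by apply/key; apply: h => //; exact: Isub.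
have pI := prime_ideal pp.
pose q (y : R) := exists2 a, f a = y & p a.
have qP a : q (f a) <-> p a.
  split=> [[b /eqP]|pa]; last by exists a.
  rewrite eq_sym -subr_eq0 -rmorphB => /eqP/fI/Ip ab.
  exact: ideal_subl.
have qp : is_prime q.
  split; first split.
  - by exists 0; [rewrite rmorph0 | exact: ideal0].
  - by move=> _ _ [a <- pa] [b <- pb]; exists (a + b); [rewrite rmorphD | exact: idealD].
  - move=> x _ [a <- pa]; have [b <-] := fS x.
    by exists (b * a); [rewrite rmorphM | exact: idealM].
  - by rewrite -(rmorph1 f) qP; apply: prime1.
  - move=> x y; have [a <-] := fS x; have [b <-] := fS y.
    by rewrite -rmorphM !qP; apply: primeM.
have := (key (prime_of qp)).1 (h _).
have -> : (fun a : Q => f a \in prime_of qp) = p :> (Q -> Prop).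
  by apply/funext => a; apply/propext; rewrite prime_ofP.
move=> kp n nl /(kp n nl)[s [sn sp rs]]; exists s; split=> // x /sp.
by move/prime_ofP; rewrite qP.
Qed.

(** The Koszul argument is carried out in the localization of Q itself at p, with J the extension of
    I. *)
Lemma wregl_colon_gen (Q : comNzRingType) (p I : Q -> Prop) (x y : seq Q) (c : Q) :
  is_prime p -> is_ideal I -> wregl p I x -> wregl p I y -> (size x < size y)%N ->
  (forall z, z \in y -> gen I x (z * c)) -> exists2 u, ~ p u & gen I x (u * c).
Proof.
move=> pp II Ix Iy xy Ic; pose P := prime_of pp.
have pP : (fun a : Q => a \in P) = p :> (Q -> Prop).
  by apply/funext => a; apply/propext; rewrite prime_ofP.
pose phi : {rmorphism Q -> localization P} := loc_map P \o idfun.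
have ph : is_loc (fun a => a = 0) p phi.
  have := @is_loc_loc_map _ P Q (fun a => a = 0) idfun; rewrite pP; apply=> [b|//].
  by exists b.
have p0 a : a = 0 -> p a by move->; apply: ideal0 (prime_ideal pp).
pose J (b : localization P) := exists t a, [/\ ~ p t, phi t * b = phi a & I a].
have sat : loc_sat p phi J I.
  move=> a; split=> [[t [b [pt e Ib]]]|[u pu Ia]]; last first.
    by exists u, (u * a); rewrite rmorphM.
  have : phi (t * a - b) = 0 by rewrite rmorphB rmorphM e subrr.
  move/(loc_eq0 ph) => [u pu ub]; exists (u * t); first exact: primeNM.
  apply: (@ideal_subl _ _ II _ (u * b)); last exact: idealM.
  rewrite -mulrA -mulrBr ub; exact: ideal0.
have JI : is_ideal J.
  split.
  - by exists 1, 0; rewrite !rmorph0 mulr0; split=> //; [exact: prime1 | exact: ideal0].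
  - move=> b d [t [a [pt e Ia]]] [s [f [ps g If]]].
    exists (t * s), (s * a + t * f); split; first exact: primeNM.
      by rewrite rmorphD !rmorphM -e -g; ring.
    by apply: idealD => //; apply: idealM.
  - move=> b d [t [a [pt e Ia]]]; have [s [f [ps g]]] := loc_frac ph b.
    exists (s * t), (f * a); split; first exact: primeNM.
      by rewrite !rmorphM -e -g; ring.
    exact: idealM.
have Jgen := loc_sat_gen pp ph x JI II sat; apply/Jgen.
apply: (@wreg_colon_gen _ J _ (map phi y)); rewrite ?size_map //.
- exact: (wregl_wreg_map pp ph JI II sat).
- exact: (wregl_wreg_map pp ph JI II sat).
- move=> _ /mapP[z zy ->]; rewrite -rmorphM; apply/Jgen; exists 1; first exact: prime1.
  by rewrite mul1r; apply: Ic.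
Qed.

(** * Monomial ideals *)

Section Monomials.
Variables (k : fieldType) (n : nat).
Local Notation Q := {mpoly k[n]}.
Implicit Types (f g h : Q) (m u : 'X_{1..n}) (F G : {set 'I_n}) (P : pred 'X_{1..n}).

Definition supp m : {set 'I_n} := [set v | m v != 0%N].

Lemma suppD m u : supp (m + u)%MM = supp m :|: supp u.
Proof. by apply/setP => v; rewrite !inE mnmDE addn_eq0 negb_and. Qed.

Lemma supp0 : supp 0%MM = set0.
Proof. by apply/setP => v; rewrite !inE mnm0E. Qed.

Lemma supp1 v : supp U_(v)%MM = [set v].
Proof. by apply/setP => w; rewrite !inE mnm1E (eq_sym w); case: (v == w). Qed.

Definition mset F : 'X_{1..n} := [multinom (v \in F : nat) | v < n].

Lemma supp_mset F : supp (mset F) = F.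
Proof. by apply/setP => v; rewrite !inE mnmE; case: (v \in F). Qed.

Definition filt P f : Q := \sum_(m <- msupp f | P m) f@_m *: 'X_[m].

Lemma mcoeff_filt P f m : (filt P f)@_m = if P m then f@_m else 0.
Proof.
rewrite /filt raddf_sum /=.
transitivity (\sum_(u <- msupp f | P u) f@_u * (u == m)%:R).
  by apply: eq_bigr => u _; rewrite mcoeffZ mcoeffX.
rewrite big_mkcond /=; case: (boolP (m \in msupp f)) => [mf|mf].
  rewrite (bigD1_seq m) ?msupp_uniq //= eqxx mulr1 big1 ?addr0 // => u /negbTE ->.
  by rewrite mulr0 if_same.
rewrite (memN_msupp_eq0 mf) if_same big_seq big1 // => u uf.
by case: eqP uf => [->|_ _]; rewrite ?(negbTE mf) ?mulr0 ?if_same.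
Qed.

Lemma filtD P f g : filt P (f + g) = filt P f + filt P g.
Proof.
by apply/mpolyP => m; rewrite !(mcoeffD, mcoeff_filt); case: ifP; rewrite ?addr0.
Qed.

Lemma filtB P f g : filt P (f - g) = filt P f - filt P g.
Proof.
by apply/mpolyP => m; rewrite !(mcoeffB, mcoeff_filt); case: ifP; rewrite ?subr0.
Qed.

Lemma filtZ P c f : filt P (c *: f) = c *: filt P f.
Proof.
by apply/mpolyP => m; rewrite !(mcoeffZ, mcoeff_filt); case: ifP; rewrite ?mulr0.
Qed.

Lemma filt0 P : filt P 0 = 0.
Proof. by rewrite /filt msupp0 big_nil. Qed.

Lemma filt_sum P (I : Type) (r : seq I) (C : pred I) (E : I -> Q) :
  filt P (\sum_(i <- r | C i) E i) = \sum_(i <- r | C i) filt P (E i).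
Proof. by apply: (big_morph _ (@filtD P) (filt0 P)). Qed.

Lemma filtX P m : filt P 'X_[m] = if P m then 'X_[m] else 0.
Proof.
apply/mpolyP => u; rewrite mcoeff_filt [RHS]fun_if mcoeffX mcoeff0.
by case: eqP => [->|]; rewrite ?if_same.
Qed.

Lemma filt_eq0 P f : (forall m, m \in msupp f -> ~~ P m) -> filt P f = 0.
Proof.
move=> fP; apply/mpolyP => m; rewrite mcoeff_filt mcoeff0; case: ifP => // Pm.
by rewrite memN_msupp_eq0 //; apply/negP => /fP; rewrite Pm.
Qed.

Lemma filtC P f : f = filt P f + filt (predC P) f.
Proof.
by apply/mpolyP => m; rewrite mcoeffD !mcoeff_filt /=; case: ifP; rewrite ?addr0 ?add0r.
Qed.

Lemma filt_msupp P f m : m \in msupp (filt P f) -> P m && (m \in msupp f).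
Proof. by rewrite !mcoeff_msupp mcoeff_filt; case: ifP; rewrite ?eqxx. Qed.

Lemma filt_mulX P P' m f : (forall u, P (m + u)%MM = P' u) ->
  filt P ('X_[m] * f) = 'X_[m] * filt P' f.
Proof.
move=> e; elim/mpolyind: f => [|c u f _ _ IH]; first by rewrite !(mulr0, filt0).
rewrite mulrDr !filtD mulrDr IH; congr (_ + _).
rewrite -scalerAr -mpolyXD !filtZ !filtX e -scalerAr.
by case: ifP; rewrite ?mulr0 // mpolyXD.
Qed.

Lemma filt_mul P P' g f : (forall m u, m \in msupp g -> P (m + u)%MM = P' u) ->
  filt P (g * f) = g * filt P' f.
Proof.
move=> e; rewrite {1}(mpolyE g) mulr_suml filt_sum [in RHS](mpolyE g) mulr_suml.
rewrite big_seq [RHS]big_seq; apply: eq_bigr => m mg.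
rewrite -scalerAl filtZ -scalerAl; congr (_ *: _); apply: filt_mulX => u; exact: e.
Qed.

(** The monomials violating P span an ideal and those satisfying it are closed under products, so
    [filt P] is a retraction compatible with multiplication. *)
Lemma filt_morph P g f : (forall m u, P (m + u)%MM = P m && P u) ->
  filt P (g * f) = filt P g * filt P f.
Proof.
move=> e; rewrite {1}(filtC P g) mulrDl filtD.
rewrite (@filt_mul _ P) => [|m u /filt_msupp/andP[Pm _]]; last by rewrite e Pm.
rewrite (@filt_mul _ pred0) => [|m u /filt_msupp/andP[/negbTE Pm _]]; last by rewrite e Pm.
by rewrite [filt pred0 f]filt_eq0 // mulr0 addr0.
Qed.

Definition mono (C : pred 'X_{1..n}) f : Prop := forall m, m \in msupp f -> C m.

Lemma mono_ideal (C : pred _) : (forall m u, C m -> C (u + m)%MM) -> is_ideal (mono C).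
Proof.
move=> up; split=> [m|f g fC gC m|a f fC m]; first by rewrite msupp0.
- by move=> /msuppD_le; rewrite mem_cat => /orP[/fC|/gC].
- move=> /msuppM_le/allpairsP[[u v] /= [ua vf ->]]; apply: up; exact: fC.
Qed.

Lemma monoX (C : pred _) m : mono C 'X_[m] <-> C m.
Proof.
split=> [|Cm u]; first by apply; rewrite msuppX mem_head.
by rewrite msuppX mem_seq1 => /eqP ->.
Qed.

Lemma mono_filt C P f : mono C f -> mono C (filt P f).
Proof. by move=> fC m /filt_msupp/andP[_ /fC]. Qed.

Lemma ideal_mpoly (J : Q -> Prop) f : is_ideal J ->
  (forall m, m \in msupp f -> J 'X_[m]) -> J f.
Proof.
move=> JI fJ; rewrite (mpolyE f) big_seq; apply: ideal_sum => // m /fJ Jm.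
by rewrite -mul_mpolyC; apply: idealM.
Qed.

(** The prime P_F generated by the variables outside F. *)
Definition face_prime F := mono (fun m => ~~ (supp m \subset F)).

Lemma face_primeE F f : face_prime F f <-> filt (fun m => supp m \subset F) f = 0.
Proof.
split=> [|f0 m mf]; first by move=> h; apply: filt_eq0.
apply/negP => mF; move: mf; rewrite mcoeff_msupp => /eqP; apply.
by have := congr1 (mcoeff m) f0; rewrite mcoeff_filt mF mcoeff0.
Qed.

Lemma filt_faceM F g f : filt (fun m => supp m \subset F) (g * f) =
  filt (fun m => supp m \subset F) g * filt (fun m => supp m \subset F) f.
Proof. by apply: filt_morph => m u; rewrite suppD subUset. Qed.

Lemma face_prime_prime F : is_prime (face_prime F).
Proof.
split.
- apply: mono_ideal => m u; apply: contra; rewrite suppD subUset.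
  by case/andP.
- by rewrite -mpolyX0 => /monoX; rewrite supp0 sub0set.
- move=> f g /face_primeE; rewrite filt_faceM => /eqP.
  by rewrite mulf_eq0 => /orP[/eqP|/eqP] /face_primeE; [left|right].
Qed.

Lemma face_primeX F m : face_prime F 'X_[m] <-> ~~ (supp m \subset F).
Proof. exact: monoX. Qed.

Lemma sub_face_prime F G f : F \subset G -> face_prime G f -> face_prime F f.
Proof. by move=> FG fG m /fG; apply: contra => mF; apply: subset_trans FG. Qed.

Lemma face_prime_face (p : Q -> Prop) F : is_ideal p ->
  (forall v, v \notin F -> p 'X_v) -> forall f, face_prime F f -> p f.
Proof.
move=> pI Fp f fF; apply: ideal_mpoly => // m /fF /subsetPn[v].
rewrite inE => mv /Fp pv.
have -> : m = ((m - U_(v)) + U_(v))%MM.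
  by apply/mnmP => w; rewrite mnmDE mnmBE mnm1E; case: eqP => [<-|]; lia.
by rewrite mpolyXD; apply: idealM.
Qed.

Definition prime_face (p : Q -> Prop) : {set 'I_n} := [set v | `[< ~ p 'X_v >]].

Lemma in_prime_face p v : v \in prime_face p <-> ~ p 'X_v.
Proof. by rewrite inE; split=> [/asboolP|?] //; apply/asboolP. Qed.

Lemma primeX (p : Q -> Prop) m : is_prime p -> supp m \subset prime_face p -> ~ p 'X_[m].
Proof.
move=> pp /subsetP mF; rewrite mpolyXE_id; apply: primeN_prod => // v _.
case: (eqVneq (m v) 0%N) => [->|mv]; first by rewrite expr0; apply: prime1.
by apply: primeNX => //; apply/in_prime_face/mF; rewrite inE.
Qed.

Lemma prime_face_sub p : is_prime p -> forall f, face_prime (prime_face p) f -> p f.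
Proof.
move=> pp; apply: face_prime_face; first exact: prime_ideal.
by move=> v /negP; rewrite in_prime_face => /contrapT.
Qed.

(** * Stanley-Reisner ideals and facets *)

Definition cplx (D : {set {set 'I_n}}) :=
  set0 \in D /\ forall F G, F \in D -> G \subset F -> G \in D.

(** The Stanley-Reisner ideal. Being a monomial ideal, it is determined by its monomials, and
    membership is read off supports. *)
Definition srI (D : {set {set 'I_n}}) := mono (fun m => supp m \notin D).

Section SR.
Variables (D : {set {set 'I_n}}) (cD : cplx D).

Lemma srI_ideal : is_ideal (srI D).
Proof.
apply: mono_ideal => m u; apply: contra => h; apply: (cD.2 _ _ h).
by rewrite suppD subsetUr.
Qed.

Lemma srIX m : srI D 'X_[m] <-> supp m \notin D.
Proof. exact: monoX. Qed.

Lemma srI_face F f : F \in D -> srI D f -> face_prime F f.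
Proof. by move=> FD fD m /fD; apply: contra => mF; apply: (cD.2 _ _ FD). Qed.

(** With [srI_face], this presents the ideal as the intersection of the primes P_F. *)
Lemma srI_faces f : (forall F, F \in D -> face_prime F f) -> srI D f.
Proof. by move=> fD m mf; apply/negP => /fD/(_ m mf); rewrite subxx. Qed.

Lemma prime_face_in p : is_prime p -> (forall f, srI D f -> p f) -> prime_face p \in D.
Proof.
move=> pp Dp; apply/negPn/negP => nD.
have /srIX/Dp : supp (mset (prime_face p)) \notin D by rewrite supp_mset.
by apply: primeX; rewrite ?supp_mset.
Qed.

Definition facet F := [forall G, (G \in D) && (F \subset G) ==> (G == F)] && (F \in D).

Lemma facetP F : reflect (F \in D /\ forall G, G \in D -> F \subset G -> G = F) (facet F).
Proof.
apply: (iffP andP) => [[/forallP h FD]|[FD h]].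
  by split=> // G GD FG; have := h G; rewrite GD FG => /eqP.
by split=> //; apply/forallP => G; apply/implyP => /andP[GD FG]; rewrite (h G).
Qed.

Lemma facet_over F : F \in D -> exists2 G, facet G & F \subset G.
Proof.
move=> FD; pose C G := (G \in D) && (F \subset G).
have CF : C F by rewrite /C FD /=.
case: (arg_maxnP (fun G : {set 'I_n} => #|G|) CF) => G /andP[GD FG] Gmax.
exists G => //; apply/facetP; split=> // H HD GH; apply/esym/eqP.
by rewrite eqEcard GH; apply: Gmax; rewrite /C HD (subset_trans FG GH).
Qed.

(* Removing the vertices of G outside F one at a time. *)
Lemma face_chain F G : G \in D -> F \subset G ->
  pchain (srI D) (face_prime F) (#|G| - #|F|).
Proof.
move=> GD FG; set N := (_ - _)%N.
have szE : size (enum (G :\: F)) = N by rewrite -cardE cardsDS.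
pose H i := G :\: [set v in take i (enum (G :\: F))].
have subH i j : (i <= j)%N -> H j \subset H i.
  move=> ij; apply: setDS; apply/subsetP => v; rewrite !inE.
  by rewrite -(take_takel _ ij) => /mem_take.
exists (fun i => face_prime (H i)); split.
- by move=> i _; apply: face_prime_prime.
- move=> i iN; split=> [f|]; first by apply: sub_face_prime; apply: subH.
  have [v0 _] : exists v, v \in G :\: F.
    by apply/set0Pn; rewrite -card_gt0 cardsDS // -/N; lia.
  set v := nth v0 (enum (G :\: F)) i.
  have vE : v \in G :\: F by rewrite -mem_enum mem_nth // szE.
  exists 'X_v; first apply/face_primeX.
    by rewrite supp1 sub1set !inE (take_nth v0) ?szE // mem_rcons mem_head //.
  rewrite face_primeX supp1 sub1set; apply/negP; rewrite negbK !inE.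
  have /setDP[-> _] := vE; rewrite andbT.
  have := enum_uniq (mem (G :\: F)).
  rewrite -{1}(cat_take_drop i (enum _)) cat_uniq => /and3P[_ /hasPn h _].
  by apply: h; rewrite (drop_nth v0) ?szE // mem_head.
- move=> f fD; apply: srI_face => //; apply: (cD.2 _ _ GD); exact: subsetDl.
- move=> f; apply: sub_face_prime; apply/subsetP => v vF.
  rewrite !inE take_oversize ?szE // mem_enum inE vF /=.
  by rewrite (subsetP FG) // andbF. 
Qed.

End SR.

End Monomials.

Lemma pchain_leq (Q : comNzRingType) (I p : Q -> Prop) (m n : nat) :
  (m <= n)%N -> pchain I p n -> pchain I p m.
Proof.
move=> mn [q [qp qs Iq qn]].
exists (fun i => q (i + (n - m))%N); split.
- by move=> i im; apply: qp; lia.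
- by move=> i im; rewrite addSn; apply: qs; lia.
- have : (0 + (n - m) <= n)%N by lia.
  elim: (0 + (n - m))%N => [//|i IH] i_n a Ia.
  by apply: (qs i i_n).1; apply: IH => //; apply: ltnW.
- by rewrite subnKC.
Qed.

(** * Gradings *)

Section Gradings.
Variables (k : fieldType) (n : nat).
Local Notation Q := {mpoly k[n]}.
Implicit Types (f g h : Q) (m u : 'X_{1..n}) (F G : {set 'I_n}) (J : Q -> Prop).

Lemma mono_mul (C : pred 'X_{1..n}) f g :
  (forall m u, m \in msupp f -> u \in msupp g -> C (m + u)%MM) -> mono C (f * g).
Proof. by move=> fg m /msuppM_le/allpairsP[[u v] /= [uf vg ->]]; apply: fg. Qed.

Definition wgraded (G : zmodType) (w : 'X_{1..n} -> G) J :=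
  forall f c, J f -> J (filt (fun m => w m == c) f).

Definition whomog (G : Type) (w : 'X_{1..n} -> G) (t : G) f :=
  forall m, m \in msupp f -> w m = t.

Section Weight.
Variables (G : zmodType) (w : 'X_{1..n} -> G).
Hypothesis wD : forall m u, w (m + u)%MM = w m + w u.

Lemma wgraded_mono (C : pred 'X_{1..n}) : wgraded w (mono C).
Proof. by move=> f c; apply: mono_filt. Qed.

(** Weights take values in a group so that the shifted degree c - t always makes sense. *)
Lemma filt_homog_mul g f t c : whomog w t g ->
  filt (fun m => w m == c) (g * f) = g * filt (fun m => w m == c - t) f.
Proof.
move=> gt; apply: filt_mul => m u /gt mt.
by rewrite wD mt [RHS]eq_sym subr_eq addrC eq_sym.
Qed.

Lemma wgraded_addi J g t : wgraded w J -> whomog w t g -> wgraded w (addi J g).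
Proof.
move=> Jw gt f c [a /Jw Ja]; exists (filt (fun m => w m == c - t) a).
by have := Ja c; rewrite filtB mulrC (filt_homog_mul _ _ gt) mulrC.
Qed.

Lemma wgraded_gen J (s : seq Q) : wgraded w J ->
  (forall g, g \in s -> exists t, whomog w t g) -> wgraded w (gen J s).
Proof.
elim: s J => //= g s IH J Jw sw; apply: IH => [|h hs].
  by have [t gt] := sw g (mem_head _ _); apply: wgraded_addi gt.
by apply: sw; rewrite in_cons hs orbT.
Qed.

End Weight.

Definition vdeg (i : 'I_n) m : int := (m i)%:Z.

Lemma vdegD i m u : vdeg i (m + u)%MM = vdeg i m + vdeg i u.
Proof. by rewrite /vdeg mnmDE PoszD. Qed.

Definition vcomp (i : 'I_n) (e : nat) := @filt k n (fun m => m i == e).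

Lemma wgraded_vcomp i J e f : wgraded (vdeg i) J -> J f -> J (vcomp i e f).
Proof. by move=> Jh Jf; have := Jh f e%:Z Jf; rewrite /vcomp /vdeg. Qed.

Lemma vcomp_mul i e g d f : whomog (fun m => m i) e g ->
  vcomp i (e + d) (g * f) = g * vcomp i d f.
Proof. by move=> ge; apply: filt_mul => m u /ge <-; rewrite mnmDE eqn_add2l. Qed.

Lemma vcomp_top i e d g f : (forall m, m \in msupp g -> (m i <= e)%N) ->
  (forall m, m \in msupp f -> (m i <= d)%N) ->
  vcomp i (e + d) (g * f) = vcomp i e g * vcomp i d f.
Proof.
move=> ge fd; rewrite {1}(filtC (fun m => m i == e) g) mulrDl /vcomp filtD.
rewrite [X in _ + X]filt_eq0 ?addr0.
  by rewrite -/(vcomp _ _ _) vcomp_mul // => m /filt_msupp/andP[/eqP].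
move=> m /msuppM_le/allpairsP[[u v] /= [/filt_msupp/andP[/= ue /ge ug] /fd vf ->]].
by rewrite mnmDE; move: ue ug vf; lia.
Qed.

Lemma vcomp_homog i e f : whomog (fun m => m i) e (vcomp i e f).
Proof. by move=> m /filt_msupp/andP[/eqP]. Qed.

Lemma whomog_exp i e g N :
  whomog (fun m => m i) e g -> whomog (fun m => m i) (N * e)%N (g ^+ N).
Proof.
move=> ge; elim: N => [|N IH] m; first by rewrite expr0 msupp1 mem_seq1 => /eqP ->; rewrite mnm0E.
rewrite exprS => /msuppM_le/allpairsP[[u v] /= [/ge ue /IH vN ->]].
by rewrite mnmDE ue vN mulSn.
Qed.

(* So g is a nonzerodivisor modulo J once its leading coefficient in the variable i
   is inverted. *)
Lemma lead_colon J i g e h : is_ideal J -> wgraded (vdeg i) J ->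
  (forall m, m \in msupp g -> (m i <= e)%N) -> J (g * h) ->
  exists N, J (vcomp i e g ^+ N * h).
Proof.
move=> JI Jh ge; set ge0 := vcomp i e g.
(* Induction on a strict bound d for the degree of h in the variable i. The power of [ge0] is
   carried along because splitting off the top part of h costs one more factor. *)
suff main d : forall h, (forall m, m \in msupp h -> (m i < d)%N) ->
    forall N, J (ge0 ^+ N * (g * h)) -> exists N, J (ge0 ^+ N * h).
  move=> Jgh; apply: (main (msize h).+1 h _ 0%N); last by rewrite expr0 mul1r.
  move=> m /msize_mdeg_lt mh; rewrite ltnS; apply: leq_trans (ltnW mh).
  by rewrite mdegE (bigD1 i) //= leq_addr.
elim: d => [|d IH] {}h hd N JN.
  suff -> : h = 0 by exists 0%N; rewrite mulr0; apply: ideal0.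
  apply/msuppnil0; case E: (msupp h) => [//|m s].
  by have := hd m; rewrite E mem_head => /(_ isT).
pose hd0 := vcomp i d h.
(* This is the component of highest possible degree N * e + (e + d), to which only the top parts of
   g and h contribute. *)
have Jtop : J (ge0 ^+ N.+1 * hd0).
  have := wgraded_vcomp (N * e + (e + d)) Jh JN.
  rewrite vcomp_mul; last exact/whomog_exp/vcomp_homog.
  by rewrite vcomp_top // exprSr mulrA.
pose h' := filt (fun m => m i != d) h.
have hE : h = hd0 + h' by apply: filtC.
have h'E : h' = h - hd0 by apply/eqP; rewrite eq_sym subr_eq addrC -hE.
have [m /filt_msupp/andP[/= md /hd]||N' JN'] := IH h' _ N.+1.
- by move: md; lia.
- have -> : ge0 ^+ N.+1 * (g * h') =
      ge0 * (ge0 ^+ N * (g * h)) - g * (ge0 ^+ N.+1 * hd0).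
    by rewrite h'E exprS; ring.
  by apply: idealB => //; apply: idealM.
exists (N' + N.+1)%N; rewrite hE mulrDr exprD; apply: idealD => //.
  by rewrite -mulrA; apply: idealM.
by rewrite mulrAC; apply: idealMr.
Qed.

End Gradings.

(** * The conditions (S_1) and (S_2) *)

Section SerreOne.
Variables (k : fieldType) (n : nat) (D : {set {set 'I_n}}) (cD : cplx D).
Local Notation Q := {mpoly k[n]}.
Local Notation srI := (@srI k n D).

(** A facet H over F is recovered from H \ F, so the monomial of G \ F has coefficient 1 in the sum,
    and it is supported in G. *)
Lemma facet_mset_sum (F G : {set 'I_n}) : facet D G -> F \subset G ->
  ~ face_prime G (\sum_(H | facet D H && (F \subset H)) 'X_[mset (H :\: F)] : Q).
Proof.
move=> fG FG /(_ (mset (G :\: F))).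
rewrite mcoeff_msupp raddf_sum /= (bigD1 G) ?fG //= mcoeffX eqxx big1 ?addr0.
  by rewrite oner_eq0 supp_mset subsetDl => /(_ isT).
move=> H /andP[/andP[_ FH] HG]; rewrite mcoeffX; case: eqP => // /(congr1 (@supp n)).
rewrite !supp_mset => e; case/eqP: HG.
by rewrite -(setID H F) -(setID G F) e (setIidPr FH) (setIidPr FG).
Qed.

(** An explicit prime avoidance: the P_G for facets G over the face of p are the minimal primes of
    [srI] contained in p. *)
Lemma facet_avoid (p : Q -> Prop) : is_prime p -> (forall f, srI f -> p f) ->
  pchain srI p 1 ->
  exists2 f, p f & forall G, facet D G -> prime_face p \subset G -> ~ face_prime G f.
Proof.
move=> pp Ip [q [qp qs Iq qn]]; have pI := prime_ideal pp; set F := prime_face p.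
(* If F is a facet, the face of q 0 contains F and so equals it. Then P_F is inside q 0, and an
   element of q 1 outside q 0 avoids P_F. *)
case: (boolP (facet D F)) => [/facetP[FD Fmax]|nF].
  have [sub [f q1 nq0]] := qs 0%N isT; exists f; first exact: qn.
  move=> G /facetP[GD _] FG; rewrite (Fmax G GD FG) => Ff; apply: nq0.
  have q0p := qp 0%N isT.
  suff FE : prime_face (q 0%N) = F by apply: prime_face_sub => //; rewrite FE.
  apply: Fmax; first exact: prime_face_in.
  by apply/subsetP => v /in_prime_face pv; apply/in_prime_face => /sub/qn.
(* If F is not a facet, every H \ F is nonempty and each term lies in p. *)
exists (\sum_(H | facet D H && (F \subset H)) 'X_[mset (H :\: F)]).
  apply: ideal_sum => // H /andP[fH FH]; apply: prime_face_sub => //.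
  rewrite -/F face_primeX supp_mset; apply/negP => HF.
  have FHE : F = H.
    apply/eqP; rewrite eqEsubset FH -(setID H F) subUset subsetIr; exact: HF.
  by case/negP: nF; rewrite FHE.
by move=> G fG FG; apply: facet_mset_sum.
Qed.

Lemma serre_ideal1 : serre_ideal 1 srI.
Proof.
move=> p pp Ip [|[|//]] _ pc; first by exists [::].
have [f pf fG] := facet_avoid pp Ip pc.
exists [:: f]; split=> // [x|]; first by rewrite mem_seq1 => /eqP ->.
(* This monomial is a unit at p and lies in P_G for the facets G that do not contain the face of p;
   for the other facets f is outside P_G. *)
split=> // a fa; exists 'X_[mset (prime_face p)].
  by apply: primeX; rewrite ?supp_mset.
apply: srI_faces => G GD; have [G' fG' GG'] := facet_over GD.
apply: sub_face_prime GG' _; have [G'D _] := facetP _ _ fG'.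
have Pp := @face_prime_prime k _ G'; have PI := prime_ideal Pp.
case: (boolP (prime_face p \subset G')) => [FG'|FG'].
  apply: (idealM PI); have := srI_face cD G'D fa.
  by case/(primeM Pp) => // Gf; case: (fG G').
by apply: (idealMr PI); apply/face_primeX; rewrite supp_mset.
Qed.

End SerreOne.

Section Purity.
Variables (k : fieldType) (n : nat) (D : {set {set 'I_n}}) (cD : cplx D).
Local Notation Q := {mpoly k[n]}.
Local Notation srI := (@srI k n D).

Lemma srI_radical (f : Q) : srI (f ^+ 2) -> srI f.
Proof.
move=> f2; apply: srI_faces => F FD; have := srI_face cD FD f2.
by rewrite expr2 => /(primeM (face_prime_prime k F))[].
Qed.

(** A monomial of s supported in F would give, after multiplication by 'X_z, a monomial supported in
    the face z |: F. *)
Lemma srI_mulX_face (F : {set 'I_n}) z (s : Q) : z |: F \in D ->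
  srI (s * 'X_z) -> face_prime F s.
Proof.
move=> zF sz m ms; apply/negP => mF.
suff : (U_(z) + m)%MM \in msupp (s * 'X_z).
  move/sz; rewrite suppD supp1 => /negP; apply; apply: (cD.2 _ _ zF).
  exact: setUS.
by rewrite mcoeff_msupp mcoeffMX -mcoeff_msupp.
Qed.

(* So the local ring at F has depth at most 1. *)
Lemma link_split (F U : {set 'I_n}) z1 z2 (f g : Q) :
  (forall H, H \in D -> F \subset H ->
     (H :\: F \subset U) || [disjoint H :\: F & U]) ->
  F \in D -> [disjoint F & U] ->
  z1 \in U -> z1 |: F \in D -> z2 \notin F -> z2 \notin U -> z2 |: F \in D ->
  face_prime F f -> face_prime F g -> ~ wregl (face_prime F) srI [:: f; g].
Proof.
move=> split FD FU z1U z1F z2F z2U z2FD Ff Fg [freg [greg _]].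
have Pp := @face_prime_prime k _ F; have PI := prime_ideal Pp.
have II := @srI_ideal k _ _ cD.
pose inU (m : 'X_{1..n}) := supp m :&: U != set0.
pose xF : Q := 'X_[mset F].
have PxF : ~ face_prime F xF by rewrite face_primeX supp_mset subxx.
(* A monomial of the product has in its support all of F, a vertex of U and a vertex outside both,
   and no face does. *)
have cross (a b : Q) : mono inU a -> mono (predC inU) b -> face_prime F b ->
    srI (xF * (a * b)).
  move=> aU bU bF; apply: mono_mul => m u; rewrite msuppX mem_seq1 => /eqP ->.
  move=> /msuppM_le/allpairsP[[u1 u2] /= [/aU u1U u2b ->]]; apply/negP.
  rewrite !suppD supp_mset => HD.
  have /subsetPn[v vu2 vF] := bF _ u2b; have /set0Pn[w /setIP[wu1 wU]] := u1U.
  have wF : w \notin F by apply: contraL wU => wF; rewrite (disjointFr FU wF).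
  have vU : v \notin U.
    apply: contra (bU _ u2b) => vU; apply/set0Pn; exists v; exact/setIP.
  have /orP[/subsetP h|h] := split _ HD (subsetUl _ _).
    by case/negP: vU; apply: h; rewrite in_setD vF 2!in_setU vu2 !orbT.
  by move/pred0P/(_ w): h; rewrite /= in_setD wF 2!in_setU wu1 wU orbT.
(* Here h * xF * a squares to 0 modulo the radical ideal [srI], so it vanishes there; then f kills
   'X_z * h * xF, which is nonzero at F, against the regularity of f. *)
have key (a b h h' : Q) z : f = a + b -> srI (xF * (a * b)) ->
    srI (xF * (b * 'X_z)) -> srI (h * a - h' * b) -> z |: F \in D ->
    ~ face_prime F h -> False.
  move=> fE ab bz hab zF Ph.
  have xha : srI (h * xF * a).
    apply: srI_radical.
    have -> : (h * xF * a) ^+ 2 =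
        h * xF * (xF * a * (h * a - h' * b) + h' * (xF * (a * b))) by ring.
    by apply: (idealM II) => //; apply: (idealD II) => //; apply: (idealM II).
  have [|u Pu] := freg ('X_z * h * xF).
    have -> : f * ('X_z * h * xF) = 'X_z * (h * xF * a) + h * (xF * (b * 'X_z)).
      by rewrite fE; ring.
    by apply: (idealD II) => //; apply: (idealM II).
  have -> : u * ('X_z * h * xF) = u * h * xF * 'X_z by ring.
  by move=> /(srI_mulX_face zF); apply: (primeNM Pp (primeNM Pp Pu Ph) PxF).
pose fU := filt inU f; pose fW := filt (predC inU) f.
pose gU := filt inU g; pose gW := filt (predC inU) g.
have fE : f = fU + fW by apply: filtC.
have gE : g = gU + gW by apply: filtC.
have mU (a : Q) : mono inU (filt inU a) by move=> m /filt_msupp/andP[].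
have mW (a : Q) : mono (predC inU) (filt (predC inU) a) by move=> m /filt_msupp/andP[].
have [fUm gUm] : mono inU fU /\ mono inU gU by split; apply: mU.
have [fWm gWm] : mono (predC inU) fW /\ mono (predC inU) gW by split; apply: mW.
have [fWF gWF] : face_prime F fW /\ face_prime F gW by split; apply: mono_filt.
(* As mixed products vanish, g * (xF * fU) agrees with xF * gU * f; regularity of g modulo f then
   makes xF * fU a multiple of f at F. *)
have [|u Pu [h Ih]] := greg (xF * fU).
  exists (xF * gU).
  have -> : g * (xF * fU) - xF * gU * f = xF * (fU * gW) - xF * (gU * fW).
    by rewrite fE gE; ring.
  by apply: (idealB II); apply: cross.
have z1m : mono inU ('X_z1 : Q).
  by apply/monoX; rewrite /inU supp1; apply/set0Pn; exists z1; rewrite !inE eqxx.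
have z2m : mono (predC inU) ('X_z2 : Q).
  apply/monoX; rewrite /= /inU supp1 negbK; apply/eqP/setP => v; rewrite !inE.
  by case: eqP => // ->; rewrite (negbTE z2U).
have z2f : face_prime F ('X_z2 : Q) by apply/face_primeX; rewrite supp1 sub1set.
have z1f : face_prime F ('X_z1 : Q).
  apply/face_primeX; rewrite supp1 sub1set; apply: contraL z1U => z1'.
  by rewrite (disjointFr FU z1').
(* The relation reads (u * xF - h) * fU = h * fW modulo [srI]. Since u * xF is outside P_F, at least
   one of the two coefficients is, and [key] applies on that side. *)
case: (pselect (face_prime F h)) => [Ph|Ph].
  apply: (key fU fW (u * xF - h) h z1) => //.
  - exact: cross.
  - by rewrite (mulrC fW); apply: cross.
  - have -> : (u * xF - h) * fU - h * fW = u * (xF * fU) - h * f by rewrite fE; ring.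
    by [].
  - by move=> /(ideal_subl PI)/(_ Ph); apply: (primeNM Pp Pu PxF).
apply: (key fW fU h (u * xF - h) z2) => //.
- by rewrite addrC.
- by rewrite (mulrC fW); apply: cross.
- exact: cross.
- have -> : h * fW - (u * xF - h) * fU = - (u * (xF * fU) - h * f) by rewrite fE; ring.
  exact: (idealN II).
Qed.

(** Downward induction on F shows that all facets over F have the same size. If this first fails at
    F, the size of the facets over v |: F sorts the link vertices v into two classes not joined by a
    face, which [link_split] rules out. *)
Lemma serre_ideal2_pure : serre_ideal 2 srI ->
  forall G1 G2, facet D G1 -> facet D G2 -> #|G1| = #|G2|.
Proof.
move=> S2.
pose uniform (F : {set 'I_n}) := forall G1 G2, facet D G1 -> facet D G2 -> F \subset G1 ->
  F \subset G2 -> #|G1| = #|G2|.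
suff unif m : forall F : {set 'I_n}, (n - #|F| <= m)%N -> F \in D -> uniform F.
  by move=> G1 G2 f1 f2; apply: (unif n set0); rewrite ?sub0set ?cards0 ?subn0 ?cD.1.
elim: m => [|m IH] F Fm FD G1 G2 f1 f2 FG1 FG2.
  have FT : F = setT.
    by apply/eqP; rewrite eqEcard subsetT cardsT card_ord -subn_eq0 -leqn0.
  have GE (G : {set 'I_n}) : F \subset G -> G = setT.
    by rewrite FT => TG; apply/eqP; rewrite eqEsubset subsetT.
  by rewrite (GE _ FG1) (GE _ FG2).
apply: contrapT => ne; have [G1D G1max] := facetP _ _ f1; have [G2D G2max] := facetP _ _ f2.
have FnG1 : F != G1 by apply: contra_notN ne => /eqP FE; rewrite FE in FG2; rewrite (G1max G2).
have FnG2 : F != G2 by apply: contra_notN ne => /eqP FE; rewrite FE in FG1; rewrite (G2max G1).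
have unif v : v \notin F -> v |: F \in D -> uniform (v |: F).
  move=> vF vFD; apply: IH => //.
  by rewrite cardsU1 vF subnS; case: (n - #|F|)%N Fm.
have [z1 z1G z1F] : exists2 v, v \in G1 & v \notin F.
  by apply/subsetPn; apply: contra FnG1 => GF; rewrite eqEsubset FG1.
have [z2 z2G z2F] : exists2 v, v \in G2 & v \notin F.
  by apply/subsetPn; apply: contra FnG2 => GF; rewrite eqEsubset FG2.
have subv v (G : {set 'I_n}) : v \in G -> F \subset G -> v |: F \subset G.
  by move=> vG FG; rewrite subUset sub1set vG.
pose U := [set v | (v \notin F) && [exists G, [&& facet D G, v |: F \subset G & #|G| == #|G1|]]].
have UP v G : v \notin F -> facet D G -> v \in G -> F \subset G ->
    (v \in U) = (#|G| == #|G1|).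
  move=> vF fG vG FG; have vFG := subv v G vG FG; rewrite inE vF /=.
  have vFD : v |: F \in D by apply: (cD.2 _ _ _ vFG); case/facetP: fG.
  apply/existsP/eqP => [[H /and3P[fH FH /eqP <-]]|GE].
    exact: (unif v vF vFD).
  by exists G; rewrite fG vFG GE eqxx.
(* Two facets of different sizes strictly contain F, so the larger one has at least two vertices
   more. *)
have dim2 : pchain srI (face_prime F) 2.
  have [c1 c2] : (#|F| < #|G1|)%N /\ (#|F| < #|G2|)%N.
    by split; apply: proper_card; rewrite properEneq ?FnG1 ?FnG2.
  have gap (x y z : nat) : (x < y)%N -> (x < z)%N -> y <> z ->
    (2 <= y - x)%N || (2 <= z - x)%N by clear; lia.
  have := gap _ _ _ c1 c2 ne.
  by case/orP=> le2; apply: (pchain_leq le2); apply: face_chain.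
have [s [s2 sF sreg]] := S2 _ (face_prime_prime k F) (fun f => srI_face cD FD) 2 (leqnn 2) dim2.
case: s s2 sF sreg => [//|f [//|g [|//]]] _ sF.
apply: (@link_split F U z1 z2) => //.
- move=> H HD FH; have [G fG HG] := facet_over HD; have FG := subset_trans FH HG.
  have UE v : v \in H :\: F -> (v \in U) = (#|G| == #|G1|).
    by move=> /setDP[vH vF]; apply: UP => //; apply: (subsetP HG).
  case E: (#|G| == #|G1|); apply/orP; [left|right].
    by apply/subsetP => v /UE ->.
  by apply/pred0P => v /=; apply/negP => /andP[/UE]; rewrite E => ->.
- apply/pred0P => v /=; apply/negP => /andP[vF]; by rewrite inE vF.
- by rewrite (UP _ G1).
- by apply: (cD.2 G1) => //; apply: subv.
- by rewrite (UP _ G2) //; apply/eqP => e; apply: ne.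
- by apply: (cD.2 G2) => //; apply: subv.
- by apply: sF; rewrite mem_head.
- by apply: sF; rewrite !inE eqxx orbT.
Qed.

End Purity.

(** * Colour sums *)

Section AssocFace.
Variables (k : fieldType) (n : nat).
Local Notation Q := {mpoly k[n]}.
Implicit Types (f g h a b : Q) (m u : 'X_{1..n}) (F G : {set 'I_n}) (J : Q -> Prop).

Lemma msetU1 F v : v \notin F -> mset (v |: F) = (U_(v) + mset F)%MM.
Proof.
move=> vF; apply/mnmP => w; rewrite mnmDE mnm1E !mnmE !inE eq_sym.
by case: eqP => // <-; rewrite (negbTE vF).
Qed.

(* F is maximal such that no power of the product of its variables kills a modulo J. *)
Lemma assoc_face J a : is_ideal J -> ~ J a -> exists F m,
  [/\ forall v, v \notin F -> J ('X_v * ('X_[m] * a))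
    & forall N, ~ J ('X_[mset F] ^+ N * ('X_[m] * a))].
Proof.
move=> JI Ja; pose C F := `[< forall N, ~ J ('X_[mset F] ^+ N * a) >].
have C0 : C set0.
  apply/asboolP => N; have -> : mset set0 = 0%MM :> 'X_{1..n}.
    by apply/mnmP => v; rewrite mnmE inE mnm0E.
  by rewrite mpolyX0 expr1n mul1r.
case: (arg_maxnP (fun F : {set 'I_n} => #|F|) C0) => F /asboolP CF Fmax.
set xF : Q := 'X_[mset F] in CF.
(* By maximality of F, enlarging F by v makes some power of the product kill a. *)
have nil v : v \notin F -> exists N, J (('X_v * xF) ^+ N * a).
  move=> vF; apply: contrapT => no.
  have /Fmax : C (v |: F).
    apply/asboolP => N JN; apply: no; exists N.
    by move: JN; rewrite msetU1 // mpolyXD.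
  by rewrite cardsU1 vF /= add1n ltnn.
(* The variables outside F are treated in turn. If e.+1 is the least power of 'X_v that kills up to
   a power of xF, then multiplying by xF ^+ N' * 'X_v ^+ e makes 'X_v itself kill and preserves what
   was achieved before. *)
suff main (s : seq 'I_n) : (forall v, v \in s -> v \notin F) ->
    exists m, (forall N, ~ J (xF ^+ N * ('X_[m] * a))) /\
      forall v, v \in s -> J ('X_v * ('X_[m] * a)).
  have [v|m [Fm sm]] := main (enum (~: F)); first by rewrite mem_enum inE.
  by exists F, m; split=> // v vF; apply: sm; rewrite mem_enum inE.
elim: s => [|v s IH] sF.
  by exists 0%MM; split=> // N; rewrite mpolyX0 mul1r.
have [w ws|m [Fm sm]] := IH; first by apply: sF; rewrite in_cons ws orbT.
pose E e := `[< exists N, J (xF ^+ N * ('X_v ^+ e * ('X_[m] * a))) >].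
have [|N JN] := nil v; first by apply: sF; rewrite mem_head.
have exE : exists e, E e.
  exists N; apply/asboolP; exists N.
  have -> : xF ^+ N * ('X_v ^+ N * ('X_[m] * a)) = 'X_[m] * (('X_v * xF) ^+ N * a).
    by rewrite exprMn; ring.
  exact: idealM.
case: (ex_minnP exE) => [[|e]] /asboolP[N' JN'] emin.
  by case: (Fm N'); move: JN'; rewrite expr0 mul1r.
have bE : 'X_[mset F *+ N' + (U_(v) *+ e + m)] * a = xF ^+ N' * ('X_v ^+ e * ('X_[m] * a)).
  by rewrite !mpolyXD -!mpolyXn !mulrA.
exists (mset F *+ N' + (U_(v) *+ e + m))%MM; rewrite bE; split=> [M JM|w].
  have : E e.
    by apply/asboolP; exists (M + N')%N; rewrite exprD -mulrA.
  by move/emin; rewrite ltnn.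
rewrite in_cons => /predU1P[->|/sm Jw].
  by move: JN'; rewrite exprS; congr J; ring.
have -> : 'X_w * (xF ^+ N' * ('X_v ^+ e * ('X_[m] * a))) =
  xF ^+ N' * 'X_v ^+ e * ('X_w * ('X_[m] * a)) by ring.
exact: idealM.
Qed.

Lemma wgraded_comps (T : eqType) (w : 'X_{1..n} -> T) J f : is_ideal J ->
  (forall c, J (filt (fun m => w m == c) f)) -> J f.
Proof.
move=> JI Jc; set s := undup [seq w m | m <- msupp f].
suff -> : f = \sum_(c <- s) filt (fun m => w m == c) f by apply: ideal_sum.
apply/mpolyP => m; rewrite raddf_sum /=.
case: (boolP (m \in msupp f)) => [mf|mf]; last first.
  rewrite (memN_msupp_eq0 mf) big1 // => c _.
  by rewrite mcoeff_filt (memN_msupp_eq0 mf) if_same.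
rewrite (bigD1_seq (w m)) ?undup_uniq ?mem_undup ?map_f //= mcoeff_filt eqxx.
by rewrite big1 ?addr0 // => c /negbTE cw; rewrite mcoeff_filt eq_sym cw.
Qed.

End AssocFace.

Section Theta.
Variables (k : fieldType) (n d : nat) (col : 'I_n -> nat).
Local Notation Q := {mpoly k[n]}.
Implicit Types (F G : {set 'I_n}) (m u : 'X_{1..n}).

Definition theta (c : nat) : Q := \sum_(v | col v == c) 'X_v.

Definition colw m : {ffun 'I_d -> int} := [ffun c : 'I_d => (\sum_(v | col v == c) m v)%N%:Z].

Lemma colwD m u : colw (m + u)%MM = colw m + colw u.
Proof.
apply/ffunP => c; rewrite !ffunE -PoszD -big_split /=; congr Posz.
by apply: eq_bigr => v _; rewrite mnmDE.
Qed.

Lemma theta_msupp c m : m \in msupp (theta c) -> exists2 v, col v = c & m = U_(v)%MM.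
Proof.
move=> /msupp_sum_le/flattenP[s /mapP[v]]; rewrite mem_filter => /andP[/eqP cv _] ->.
by rewrite msuppX mem_seq1 => /eqP ->; exists v.
Qed.

Lemma theta_whomog c :
  whomog colw [ffun c' : 'I_d => (c == c' :> nat)%:R] (theta c).
Proof.
move=> m /theta_msupp[v cv ->]; apply/ffunP => c'; rewrite !ffunE.
case: (eqVneq c (c' : nat)) => [cc'|cc'].
  rewrite (bigD1 v) ?cv ?cc' //= mnm1E eqxx big1 // => w /andP[_ wv].
  by rewrite mnm1E eq_sym (negbTE wv).
rewrite big1 // => w /eqP wc'; rewrite mnm1E; case: eqP => // vw.
by case/eqP: cc'; rewrite -cv vw.
Qed.

Variable D : {set {set 'I_n}}.
Hypotheses (cD : cplx D)
  (col_inj : forall F v w, F \in D -> v \in F -> w \in F -> col v = col w -> v = w)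
  (col_lt : forall F v, F \in D -> v \in F -> (col v < d)%N).
Local Notation srI := (@srI k n D).

(** Two distinct vertices of one colour never lie in a common face, so 'X_v times its colour sum is
    'X_v ^+ 2 modulo [srI]. *)
Lemma mulX_theta v (J : Q -> Prop) b : is_ideal J -> (forall f, srI f -> J f) ->
  J (theta (col v) * b) -> J ('X_v ^+ 2 * b).
Proof.
move=> JI IJ Jb.
have -> : 'X_v ^+ 2 * b = 'X_v * (theta (col v) * b) -
    \sum_(w | (col w == col v) && (w != v)) 'X_v * 'X_w * b.
  rewrite {1}/theta (bigD1 v) //= mulrDl mulrDr.
  by rewrite -mulr_suml -mulr_sumr; ring.
apply: idealB => //; first exact: idealM.
apply: ideal_sum => // w /andP[/eqP wv ne]; apply: idealMr => //; apply: IJ.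
rewrite -mpolyXD; apply/srIX; rewrite suppD !supp1; apply/negP => vwD.
by case/eqP: ne; apply: (col_inj vwD) => //; rewrite !inE eqxx ?orbT.
Qed.

Lemma card_face_colors F (ts : seq nat) : F \in D -> uniq ts ->
  (forall t, t \in ts -> (t < d)%N) -> (forall v, v \in F -> col v \notin ts) ->
  (#|F| + size ts <= d)%N.
Proof.
move=> FD uts tsd Fts; rewrite cardE -(size_map col) -size_cat -[leqRHS](size_iota 0 d).
apply: uniq_leq_size.
  rewrite cat_uniq uts andbT map_inj_in_uniq ?enum_uniq /=; last first.
    by move=> v w; rewrite !mem_enum; apply: col_inj.
  apply/hasPn => t tts; apply/mapP => -[v]; rewrite mem_enum => /Fts vt te.
  by rewrite -te tts in vt.
move=> t; rewrite mem_cat mem_iota /= => /orP[/mapP[v]|/tsd //].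
by rewrite mem_enum => /(col_lt FD) vd ->.
Qed.

(** A face has at most one vertex of each colour, so its exponents can be read off the colour
    degree. *)
Lemma colw_inj F m u : F \in D -> supp m \subset F -> supp u \subset F ->
  colw m = colw u -> m = u.
Proof.
move=> FD mF uF /ffunP e; apply/mnmP => v.
case: (boolP (v \in F)) => [vF|vF]; last first.
  have z (x : 'X_{1..n}) : supp x \subset F -> x v = 0%N.
    by move=> xF; apply/eqP; apply: contraNT vF => xv; apply: (subsetP xF); rewrite inE.
  by rewrite !z.
have := e (Ordinal (col_lt FD vF)); rewrite !ffunE => -[].
have s (x : 'X_{1..n}) : supp x \subset F -> (\sum_(w | col w == col v) x w)%N = x v.
  move=> xF; rewrite (bigD1 v) //= big1 ?addn0 // => w /andP[/eqP wv ne].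
  apply/eqP; apply: contraNT ne => xw; apply/eqP.
  by apply: (col_inj FD) => //; apply: (subsetP xF); rewrite inE.
by rewrite !s.
Qed.

(* Distinct monomials in the variables of F have distinct colour degrees. *)
Lemma homog_not_killed (J : Q -> Prop) F (b u : Q) c : is_ideal J -> wgraded colw J ->
  F \in D -> whomog colw c b -> (forall f, face_prime F f -> J (f * b)) ->
  (forall N, ~ J ('X_[mset F] ^+ N * b)) -> ~ face_prime F u -> ~ J (u * b).
Proof.
move=> JI Jw FD bc Fb nb Fu Jub; set v := filt (fun m => supp m \subset F) u.
have Jvb : J (b * v).
  have -> : b * v = u * b - filt (predC (fun m => supp m \subset F)) u * b.
    by rewrite {1}(filtC (fun m => supp m \subset F) u) -/v; ring.
  by apply: idealB => //; apply: Fb => m /filt_msupp/andP[].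
have [m mv] : exists m, m \in msupp v.
  case E: (msupp v) => [|m s]; last by exists m; rewrite mem_head.
  by case: Fu; apply/face_primeE; apply: msuppnil0.
have mF : supp m \subset F by case/andP: (filt_msupp mv).
(* In this degree b * v reduces to the single term of m. *)
have := Jw _ (c + colw m) Jvb.
rewrite (filt_homog_mul colwD _ _ bc) addrAC subrr add0r.
have -> : filt (fun x => colw x == colw m) v = v@_m *: 'X_[m].
  apply/mpolyP => x; rewrite mcoeff_filt mcoeffZ mcoeffX eq_sym.
  case: (eqVneq m x) => [->|mx]; first by rewrite eqxx mulr1.
  rewrite mulr0; case: eqP => // e; apply: memN_msupp_eq0; apply/negP.
  move=> /filt_msupp/andP[xF _]; case/eqP: mx; exact: (colw_inj FD).
(* The total degree of m bounds its exponents, so 'X_[m] divides this power of the product over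
   F. *)
move: mv; rewrite mcoeff_msupp => mv Jm; apply: (nb (mdeg m)).
have -> : 'X_[mset F] ^+ mdeg m * b =
    'X_[mset F *+ mdeg m - m] * (v@_m)^-1%:MP * (b * (v@_m *: 'X_[m])).
  rewrite mpolyXn -mul_mpolyC.
  transitivity ('X_[mset F *+ mdeg m - m] * 'X_[m] *
    ((v@_m)^-1%:MP * (v@_m)%:MP) * b); last by ring.
  rewrite -mpolyCM mulVf // mpolyC1 mulr1 -mpolyXD submK //.
  apply/mnm_lepP => x; rewrite mulmnE mnmE.
  case: (boolP (x \in F)) => [xF|xF]; first by rewrite mul1n mdegE (bigD1 x) //= leq_addr.
  suff /eqP -> : m x == 0%N by [].
  by apply: contraNT xF => mx; apply: (subsetP mF); rewrite inE.
exact: idealM.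
Qed.

Hypothesis top : exists2 F, F \in D & #|F| = d.

Lemma card_facet l F : (1 < l)%N -> serre_ideal l srI -> facet D F -> #|F| = d.
Proof.
move=> l1 Sl fF; have [G GD Gd] := top; have [H fH GH] := facet_over GD.
have S2 : serre_ideal 2 srI.
  by move=> p pp Ip m m2; apply: Sl => //; apply: leq_trans l1.
rewrite (serre_ideal2_pure cD S2 fF fH); apply/eqP; rewrite eqn_leq.
have [HD _] := facetP _ _ fH.
have := @card_face_colors H [::] HD isT; rewrite addn0 => -> //=.
by rewrite -Gd subset_leq_card.
Qed.

Lemma theta_wreg l (ts : seq nat) : (1 < l)%N -> serre_ideal l srI -> uniq ts ->
  (forall t, t \in ts -> (t < d)%N) -> (size ts <= l)%N -> wreg srI (map theta ts).
Proof.
move=> l1 Sl; elim/last_ind: ts => [//|ts t IH].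
rewrite rcons_uniq size_rcons => /andP[tts uts] tsd tsl; rewrite map_rcons.
have tsd' x : x \in ts -> (x < d)%N.
  by move=> xts; apply: tsd; rewrite mem_rcons in_cons xts orbT.
have Its := IH uts tsd' (ltnW tsl).
apply/wreg_rcons; split=> // a0 Ja0; set J := gen srI (map theta ts) in Ja0 *.
have II := @srI_ideal k _ _ cD; have JI : is_ideal J by apply: gen_ideal.
have IJ f : srI f -> J f by apply: sub_gen.
have Jw : wgraded colw J.
  apply: (wgraded_gen colwD); first exact: wgraded_mono.
  by move=> _ /mapP[c _ ->]; exists [ffun c' : 'I_d => (c == c' :> nat)%:R]; apply: theta_whomog.
(* J is graded by colours, so a counterexample may be taken homogeneous. *)
apply: (wgraded_comps (w := colw)) => // c; apply: contrapT => nJa.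
set a := filt (fun m => colw m == c) a0 in nJa.
have Ja : J (theta t * a).
  have := Jw _ (c + [ffun c' : 'I_d => (t == c' :> nat)%:R]) Ja0.
  by rewrite (filt_homog_mul colwD _ _ (@theta_whomog t)) addrK.
have [F [m [Fv FN]]] := assoc_face JI nJa; set b := 'X_[m] * a in Fv FN.
have Jb t' : t' \in rcons ts t -> J (theta t' * b).
  rewrite mem_rcons in_cons => /predU1P[->|t'ts].
    by rewrite mulrCA; apply: idealM.
  by apply: idealMr => //; apply: mem_gen => //; apply: map_f.
have FD : F \in D.
  apply/negPn/negP => nFD; apply: (FN 1%N); rewrite expr1; apply: idealMr => //.
  by apply: IJ; apply/srIX; rewrite supp_mset.
(* Otherwise 'X_v ^+ 2, hence the square of the product over F, would kill b. *)
have Fcol v : v \in F -> col v \notin rcons ts t.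
  move=> vF; apply/negP => /Jb /(mulX_theta JI IJ) Jv; apply: (FN 2).
  have -> : mset F = (U_(v) + mset (F :\ v))%MM.
    by rewrite -msetU1 ?setD1K // !inE eqxx.
  rewrite mpolyXD exprMn mulrAC; apply: idealMr => //.
have cardF : (#|F| + (size ts).+1 <= d)%N.
  by rewrite -(size_rcons ts t); apply: card_face_colors => //; rewrite rcons_uniq tts.
have Pp := @face_prime_prime k _ F.
have [G fG FG] := facet_over FD; have [GD _] := facetP _ _ fG.
(* Facets have d vertices by purity, while F misses size ts + 1 colours. So (S_l) yields a sequence
   y at P_F one longer than ts. *)
have ch : pchain srI (face_prime F) (size ts).+1.
  apply: (@pchain_leq _ _ _ _ (#|G| - #|F|)); last exact: face_chain.
  by rewrite (card_facet l1 Sl fG); lia.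
have [y [sy yF yreg]] := Sl _ Pp (fun f => srI_face cD FD) _ tsl ch.
have FJ f : face_prime F f -> J (f * b).
  apply: (@face_prime_face _ _ (fun f => J (f * b))) => //; split.
  - by rewrite mul0r; apply: ideal0.
  - by move=> f1 g Jf Jg; rewrite mulrDl; apply: idealD.
  - by move=> f1 g Jg; rewrite -mulrA; apply: idealM.
(* The elements of y lie in P_F and kill b modulo J, so b vanishes at P_F, against
   [homog_not_killed]. *)
have [||z zy|u Fu] := @wregl_colon_gen _ _ _ (map theta ts) y b Pp II _ yreg.
- exact: wreg_wregl.
- by rewrite sy size_map.
- by apply: FJ; apply: yF.
apply: (homog_not_killed JI Jw FD (c := colw m + c)) => // x.
move=> /msuppM_le/allpairsP[[x1 x2] /= []]; rewrite msuppX mem_seq1 => /eqP ->.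
by move=> /filt_msupp/andP[/eqP <- _] ->; rewrite colwD.
Qed.

End Theta.

(** * Rank selection *)

Lemma gen_mono (Q : comNzRingType) (I J : Q -> Prop) (s : seq Q) : is_ideal J ->
  (forall x, I x -> J x) -> forall x, gen I s x -> gen J s x.
Proof.
move=> JI IJ x; apply: gen_min; first exact: gen_ideal.
- by move=> y /IJ; apply: sub_gen.
- by move=> y; apply: mem_gen.
Qed.

Section RankSelection.
Variables (k : fieldType) (n : nat) (col : 'I_n -> nat) (D : {set {set 'I_n}}).
Variables (cD : cplx D) (W : {set 'I_n}).
Local Notation Q := {mpoly k[n]}.

Definition induced_faces := [set F in D | F \subset W].

Lemma induced_cplx : cplx induced_faces.
Proof.
split=> [|F G]; rewrite !inE ?sub0set ?cD.1 // => /andP[FD FW] GF.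
by rewrite (cD.2 F) // (subset_trans GF).
Qed.

Local Notation rho := (@filt k n (fun m => supp m \subset W)).
Local Notation theta := (theta k col).

Lemma rho_theta c f : (forall v, col v = c -> v \in W) ->
  rho (theta c * f) = theta c * rho f.
Proof.
move=> cW; apply: filt_mul => m u /theta_msupp[v /cW vW ->].
by rewrite suppD subUset supp1 sub1set vW.
Qed.

(** The retraction [rho] kills the variables outside W, commutes with multiplication by these colour
    sums and carries the ideal of the induced complex into that of D. Conversely, f - rho f lies in
    the ideal of the induced complex, which contains that of D. *)
Lemma gen_induced (ts : seq nat) f :
  (forall c v, c \in ts -> col v = c -> v \in W) ->
  gen (@srI k n induced_faces) (map theta ts) f <->
  gen (@srI k n D) (map theta ts) (rho f).
Proof.
move=> tsW; have I1 := @srI_ideal k _ _ cD; have I2 := @srI_ideal k _ _ induced_cplx.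
have G1 := gen_ideal (map theta ts) I1; have G2 := gen_ideal (map theta ts) I2.
split.
  apply: (@gen_min _ _ _ (fun f => gen (@srI k n D) (map theta ts) (rho f))).
  - split=> [|f1 f2 J1 J2|f1 f2 J2].
    + by rewrite filt0; apply: ideal0.
    + by rewrite filtD; apply: idealD.
    + by rewrite filt_faceM; apply: idealM.
  - move=> g gI; apply: sub_gen => // m /filt_msupp/andP[mW /gI].
    by rewrite inE mW andbT.
  - move=> _ /mapP[c cts ->]; rewrite -[theta c]mulr1 rho_theta => [|v].
      by apply: idealMr => //; apply: mem_gen => //; apply: map_f.
    exact: tsW.
move=> Jf; rewrite (filtC (fun m => supp m \subset W) f); apply: idealD => //.
  apply: gen_mono Jf => // g gD m /gD; apply: contra.
  by rewrite inE => /andP[].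
by apply: sub_gen => // m /filt_msupp/andP[/negbTE mW _]; rewrite inE mW andbF.
Qed.

Lemma theta_wreg_induced (ts : seq nat) :
  (forall c v, c \in ts -> col v = c -> v \in W) ->
  wreg (@srI k n D) (map theta ts) -> wreg (@srI k n induced_faces) (map theta ts).
Proof.
elim/last_ind: ts => //= ts t IH tsW; rewrite map_rcons !wreg_rcons => -[hts ht].
have tsW' c v : c \in ts -> col v = c -> v \in W.
  by move=> cts; apply: tsW; rewrite mem_rcons in_cons cts orbT.
split=> [|a]; first exact: IH.
rewrite !gen_induced // rho_theta; first exact: ht.
by move=> v; apply: tsW; rewrite mem_rcons mem_head.
Qed.

End RankSelection.

(** * Length of chains of primes *)

Section ChainBound.
Variables (k : fieldType) (n : nat).
Local Notation Q := {mpoly k[n]}.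
Implicit Types (p q : Q -> Prop) (U F : {set 'I_n}) (m : 'X_{1..n}).

Definition lindep_free p (I : finType) (e : I -> Q) :=
  forall c : I -> k, p (\sum_i c i *: e i) -> forall i, c i = 0.

(** The images of the variables of U are algebraically independent modulo p. *)
Definition alg_free p U :=
  forall h : Q, mono (fun m => supp m \subset U) h -> p h -> h = 0.

(* Reduce modulo q', where only the constant term in f survives, then divide by f. *)
Lemma lindep_free_powers q q' (I : finType) (e : I -> Q) f s :
  is_prime q -> is_prime q' -> (forall a, q a -> q' a) -> q' f -> ~ q f ->
  lindep_free q' e -> lindep_free q (fun x : I * 'I_s => f ^+ x.2 * e x.1).
Proof.
move=> qp qp' qq' q'f qf ef c.
have qI := prime_ideal qp; have qI' := prime_ideal qp'.
have main t : forall b : I -> nat -> k,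
    q (\sum_(j < t) f ^+ j * (\sum_i b i j *: e i)) ->
    forall i j, (j < t)%N -> b i j = 0.
  elim: t => [//|t IH] b; rewrite big_ord_recl expr0 mul1r.
  have -> : \sum_(j < t) f ^+ lift ord0 j * (\sum_i b i (lift ord0 j) *: e i) =
      f * \sum_(j < t) f ^+ j * (\sum_i b i j.+1 *: e i).
    by rewrite mulr_sumr; apply: eq_bigr => j _; rewrite /= exprS mulrA.
  move=> qb; have b0 i : b i 0%N = 0.
    apply: (ef (fun i => b i 0%N)); apply: (@ideal_subl _ _ qI' _
      (- (f * \sum_(j < t) f ^+ j * (\sum_i b i j.+1 *: e i)))).
      by rewrite opprK; apply: qq'.
    by apply: idealN => //; apply: idealMr.
  move=> i [|j] jt; first exact: b0.
  apply: (IH (fun i j => b i j.+1)) => //.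
  move: qb; rewrite big1 ?add0r => [/(primeM qp)[]|i' _] //.
  by rewrite b0 scale0r.
move=> qc [i j].
have := main s (fun i j => if insub j is Some j' then c (i, j') else 0) _ i j (ltn_ord j).
rewrite valK; apply.
congr q: qc; transitivity (\sum_(j < s) \sum_i c (i, j) *: (f ^+ j * e i)).
  by rewrite exchange_big pair_big /=; apply: eq_bigr => -[].
apply: eq_bigr => j' _; rewrite mulr_sumr; apply: eq_bigr => i' _.
by rewrite valK scalerAr.
Qed.

(** Exponent vectors on U with entries below s, indexed by a finite type with s ^ #|U| elements. *)
Definition mnm_of U s (phi : {ffun {v | v \in U} -> 'I_s}) : 'X_{1..n} :=
  [multinom (if insub v is Some u then phi u : nat else 0%N) | v < n].

Lemma mnm_of_in U s (phi : {ffun {v | v \in U} -> 'I_s}) u :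
  mnm_of phi (val u) = phi u.
Proof. by rewrite mnmE valK. Qed.

Lemma mnm_of_notin U s (phi : {ffun {v | v \in U} -> 'I_s}) v :
  v \notin U -> mnm_of phi v = 0%N.
Proof. by move=> vU; rewrite mnmE insubN. Qed.

Lemma mnm_of_supp U s (phi : {ffun {v | v \in U} -> 'I_s}) : supp (mnm_of phi) \subset U.
Proof. by apply/subsetP => v; rewrite inE; apply: contraNT => /mnm_of_notin ->. Qed.

Lemma mnm_of_inj U s : injective (@mnm_of U s).
Proof.
move=> phi psi e; apply/ffunP => u; apply: val_inj => /=.
by rewrite -!mnm_of_in e.
Qed.

Lemma mnm_of_le U s (phi : {ffun {v | v \in U} -> 'I_s}) v : (mnm_of phi v <= s)%N.
Proof. by rewrite mnmE; case: insub => // u; apply: ltnW. Qed.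

(** The monomials in x_U start with s ^ #|U| independent elements, and each strict inclusion
    multiplies their number by s through the powers of a witness. That C does not depend on s is
    what the growth comparison needs. *)
Lemma chain_lindep_free p U N (q : nat -> Q -> Prop) : alg_free p U ->
  (forall i, (i <= N)%N -> is_prime (q i)) ->
  (forall i, (i < N)%N -> (forall a, q i a -> q i.+1 a) /\ exists2 a, q i.+1 a & ~ q i a) ->
  (forall a, q N a -> p a) ->
  exists C, forall s, exists (I : finType) (e : I -> Q),
    [/\ #|I| = (s ^ (#|U| + N))%N, lindep_free (q 0%N) e
      & forall i m v, m \in msupp (e i) -> (m v <= C * s)%N].
Proof.
move=> pU; elim: N q => [|N IH] q qp qs qn.
  exists 1%N => s; exists {ffun {v | v \in U} -> 'I_s}, (fun phi => 'X_[mnm_of phi]).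
  split.
  - by rewrite card_ffun card_ord card_sig addn0.
  - move=> c /qn pc phi; have : \sum_phi c phi *: 'X_[mnm_of phi] = 0 :> Q.
      apply: pU pc => m /msupp_sum_le/flattenP[_ /mapP[psi _ ->]] /msuppZ_le.
      by rewrite msuppX mem_seq1 => /eqP ->; apply: mnm_of_supp.
    move/(congr1 (mcoeff (mnm_of phi))); rewrite mcoeff0 raddf_sum (bigD1 phi) //=.
    rewrite mcoeffZ mcoeffX eqxx mulr1 big1 ?addr0 // => psi ne.
    by rewrite mcoeffZ mcoeffX (inj_eq (@mnm_of_inj _ _)) (negbTE ne) mulr0.
  - by move=> phi m v; rewrite msuppX mem_seq1 => /eqP ->; rewrite mul1n mnm_of_le.
have [||//|C HC] := IH (fun i => q i.+1).
- by move=> i iN; apply: qp.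
- by move=> i iN; apply: qs.
have [sub [f q1f q0f]] := qs 0%N isT.
exists (msize f + C)%N => s; have [I [e [cI ef eC]]] := HC s.
exists (I * 'I_s)%type, (fun x : I * 'I_s => f ^+ x.2 * e x.1); split.
- by rewrite card_prod card_ord cI -expnSr addnS.
- exact: lindep_free_powers (qp 0%N isT) (qp 1%N isT) sub q1f q0f ef.
move=> [i j] m v /msuppM_le/allpairsP[[m1 m2] /= [m1f /eC m2e ->]].
rewrite mnmDE mulnDl leq_add //; apply: (@leq_trans (j * msize f)); last first.
  by rewrite mulnC leq_mul2l (ltnW (ltn_ord j)) orbT.
elim: (j : nat) m1 m1f => [|a IHa] m1.
  by rewrite expr0 msupp1 mem_seq1 => /eqP ->; rewrite mnm0E.
rewrite exprS => /msuppM_le/allpairsP[[u1 u2] /= [/msize_mdeg_lt u1f /IHa u2f ->]].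
rewrite mnmDE mulSn leq_add //; apply: leq_trans (ltnW u1f).
by rewrite mdegE (bigD1 v) //= leq_addr.
Qed.

(** Modulo P_F only B.+1 ^ #|F| monomials with exponents at most B survive; a larger family has a
    coefficient matrix with a nonzero left kernel, which is a linear relation. *)
Lemma lindep_free_card q F (I : finType) (e : I -> Q) B :
  (forall f, face_prime F f -> q f) -> lindep_free q e ->
  (forall i m v, m \in msupp (e i) -> (m v <= B)%N) -> (#|I| <= B.+1 ^ #|F|)%N.
Proof.
move=> Fq ef eB; pose M := {ffun {v | v \in F} -> 'I_B.+1}.
have cM : #|{: M}| = (B.+1 ^ #|F|)%N by rewrite card_ffun card_ord card_sig.
rewrite -cM leqNgt; apply/negP => MI.
pose A : 'M[k]_(#|I|, #|{: M}|) := \matrix_(i, j) (e (enum_val i))@_(mnm_of (enum_val j)).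
have /rowV0Pn[c cK c0] : kermx A != 0.
  rewrite kermx_eq0 -row_leq_rank -ltnNge; apply: leq_ltn_trans MI; exact: rank_leq_col.
have /sub_kermxP cA := cK.
case/eqP: c0; apply/rowP => i; rewrite mxE.
have := ef (fun x => c 0 (enum_rank x)) _ (enum_val i); rewrite enum_valK; apply.
apply: Fq => m mh; apply/negP => mF.
have mB v : (m v <= B)%N.
  move: mh => /msupp_sum_le/flattenP[_ /mapP[x _ ->]] /msuppZ_le; exact: eB.
pose phi : M := [ffun u => inord (m (val u))].
have mE : m = mnm_of phi.
  apply/mnmP => v; case: (boolP (v \in F)) => vF.
    by rewrite -[v]/(val (Sub v vF : {v | v \in F})) mnm_of_in ffunE inordK // ltnS.
  rewrite mnm_of_notin //; apply/eqP; apply: contraNT vF => mv.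
  by apply: (subsetP mF); rewrite inE.
move: mh; rewrite mcoeff_msupp raddf_sum => /eqP; apply.
have := congr1 (fun X : 'rV_ _ => X 0 (enum_rank phi)) cA; rewrite !mxE => cA0.
rewrite -[RHS]cA0 (reindex (@enum_val I predT)) /=; last first.
  by apply: onW_bij; apply: enum_val_bij.
by apply: eq_bigr => j _; rewrite mcoeffZ enum_valK mxE enum_rankK -mE.
Qed.

(** Otherwise the independent family obtained from the chain would outgrow the monomials available
    on the face of q 0. *)
Lemma pchain_bound (D : {set {set 'I_n}}) p U N : cplx D -> alg_free p U ->
  pchain (@srI k n D) p N -> exists2 F, F \in D & (#|U| + N <= #|F|)%N.
Proof.
move=> cD pU [q [qp qs Dq qn]]; exists (prime_face (q 0%N)).
  by apply: (prime_face_in (k := k)) => //; apply: qp.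
have [C HC] := chain_lindep_free pU qp qs qn.
set a := (_ + _)%N; set r := #|_|; rewrite leqNgt; apply/negP => ra.
(* This t gives (C.+1 * t.+1) ^ r = t * t.+1 ^ r < t.+1 ^ r.+1. *)
set t := (C.+1 ^ r)%N; have [I [e [cI ef eC]]] := HC t.+1.
have := lindep_free_card (prime_face_sub (qp 0%N isT)) ef eC; rewrite cI -/a -/r.
apply/negP; rewrite -ltnNge.
have h1 : ((C * t.+1).+1 ^ r <= (C.+1 * t.+1) ^ r)%N.
  move: (t) => u; case: (posnP r) => [->|r0]; first by rewrite !expn0.
  by rewrite leq_exp2r //; nia.
apply: leq_ltn_trans h1 _; rewrite expnMn -/t.
apply: (@leq_trans (t.+1 ^ r.+1)); last by rewrite leq_pexp2l.
by rewrite expnS ltn_mul2r expn_gt0 /=.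
Qed.

End ChainBound.

(** * From colour sums to Serre's condition *)

Section ThetaSerre.
Variables (k : fieldType) (n : nat) (col : 'I_n -> nat) (D : {set {set 'I_n}}).
Variables (cD : cplx D) (cs : seq nat) (ucs : uniq cs).
Local Notation Q := {mpoly k[n]}.
Local Notation srI := (@srI k n D).
Local Notation theta := (theta k col).
Hypotheses
  (col_inj : forall F v w, F \in D -> v \in F -> w \in F -> col v = col w -> v = w)
  (col_cs : forall F v, F \in D -> v \in F -> col v \in cs).

Lemma card_face_cs F : F \in D -> (#|F| <= size cs)%N.
Proof.
move=> FD; rewrite cardE -(size_map col); apply: uniq_leq_size.
  rewrite map_inj_in_uniq ?enum_uniq // => v w; rewrite !mem_enum; exact: col_inj.
by move=> c /mapP[v]; rewrite mem_enum => vF ->; apply: (col_cs FD).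
Qed.

Lemma alg_free_maximal (p : Q -> Prop) (F : {set 'I_n}) : is_prime p -> exists2 U : {set 'I_n},
  U \subset F /\ alg_free p U & forall i, i \in F :\: U ->
    exists g : Q, [/\ g <> 0, mono (fun m => supp m \subset i |: U) g & p g].
Proof.
move=> pp; have pI := prime_ideal pp.
pose C (U : {set 'I_n}) := `[< U \subset F /\ alg_free p U >].
(* A polynomial in no variables is a constant, and a nonzero constant in p would put 1 in p. *)
have C0 : C set0.
  apply/asboolP; split=> [|h h0 ph]; first exact: sub0set.
  have hE : h = h@_0 *: 1.
    apply/mpolyP => m; rewrite mcoeffZ mcoeff1.
    case: (eqVneq m 0%MM) => [->|m0]; rewrite ?mulr1 // mulr0.
    apply: memN_msupp_eq0; apply: contra m0 => /h0; rewrite subset0 => /eqP s0.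
    apply/eqP/mnmP => v; rewrite mnm0E; apply/eqP; rewrite -[_ == _]negbK.
    by have := in_set0 v; rewrite -s0 inE => ->.
  set c := h@_0 in hE; case: (eqVneq c 0) => [e|ne]; first by rewrite hE e scale0r.
  case: (prime1 pp); have -> : 1 = c^-1%:MP * h.
    by rewrite hE -mul_mpolyC mulr1 -mpolyCM mulVf.
  exact: idealM.
case: (arg_maxnP (fun U : {set 'I_n} => #|U|) C0) => U /asboolP[UF Ufree] Umax.
exists U => // i /setDP[iF iU]; apply: contrapT => no.
have /Umax : C (i |: U).
  apply/asboolP; split=> [|h hU ph]; first by rewrite subUset sub1set iF.
  by apply: contrapT => h0; apply: no; exists h.
by rewrite cardsU1 iU /= add1n ltnn.
Qed.

(** The top part of g in 'X_i is 'X_i ^+ e times a nonzero polynomial in x_U, and neither factor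
    lies in p. *)
Lemma alg_free_lead (p : Q -> Prop) U i (g : Q) : is_prime p -> alg_free p U ->
  ~ p 'X_i -> g <> 0 -> mono (fun m => supp m \subset i |: U) g -> exists e,
  (forall m, m \in msupp g -> (m i <= e)%N) /\ ~ p (vcomp i e g).
Proof.
move=> pp pU pi g0 gU; pose e := \max_(m <- msupp g) m i; exists e.
have ge m : m \in msupp g -> (m i <= e)%N.
  by move=> mg; rewrite /e (big_rem m) //= leq_maxl.
split=> // pg; set g1 := vcomp i e g in pg.
pose a : Q := \sum_(m <- msupp g1) g1@_m *: 'X_[m - U_(i) *+ e].
have g1E : g1 = 'X_i ^+ e * a.
  rewrite {1}(mpolyE g1) mulr_sumr big_seq [RHS]big_seq; apply: eq_bigr => m.
  move=> /filt_msupp/andP[/eqP me _].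
  rewrite -scalerAr mpolyXn -mpolyXD addmC submK //.
  by apply/mnm_lepP => v; rewrite mulmnE mnm1E; case: eqP => [<-|]; rewrite ?mul1n ?me.
have a0 : a = 0.
  apply: pU => [m|].
    rewrite /a => /msupp_sum_le/flattenP[_ /mapP[u ug1 ->]] /msuppZ_le.
    rewrite msuppX mem_seq1 => /eqP ->.
    move: ug1; rewrite mem_filter /= => /filt_msupp/andP[/eqP ue /gU uU].
    apply/subsetP => v; rewrite inE mnmBE mulmnE mnm1E => h.
    have : v \in supp u by rewrite inE; lia.
    move/(subsetP uU); rewrite !inE => /predU1P[vi|//].
    by move: h; rewrite vi eqxx mul1n ue subnn.
  by move: pg; rewrite g1E => /(primeM pp)[]// /primeNX; case.
have gn0 : (0 < size (msupp g))%N.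
  by rewrite lt0n size_eq0 msupp_eq0; apply/eqP.
have [m mg me] : exists2 m, m \in msupp g & m i = e.
  rewrite /e; move: (msupp g) gn0 {ge a a0 g1E g1 pg e gU} => [//|m s] _.
  elim: s m => [|u s IH] m; first by exists m; rewrite ?big_seq1 ?mem_head.
  have [m' m's e'] := IH u; rewrite big_cons -e'.
  case: (leqP (m i) (m' i)) => h; [exists m' | exists m]; rewrite ?mem_head //.
  by rewrite in_cons m's orbT.
have := congr1 (mcoeff m) g1E; rewrite a0 mulr0 mcoeff0 mcoeff_filt me eqxx => /eqP.
by apply/negP; rewrite -mcoeff_msupp.
Qed.

(** Each g i is regular at p by its leading coefficient. It does not involve the later variables
    'X_j, so adding it keeps the ideal graded in them. *)
Lemma alg_free_wregl (p J : Q -> Prop) U (g : 'I_n -> Q) (s : seq 'I_n) :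
  is_prime p -> is_ideal J -> alg_free p U -> uniq s ->
  (forall i, i \in s -> [/\ i \notin U, ~ p 'X_i, wgraded (vdeg i) J,
     g i <> 0 & mono (fun m => supp m \subset i |: U) (g i)]) ->
  wregl p J (map g s).
Proof.
move=> pp JI pU; elim: s J JI => //= i s IH J JI /andP[is_ us] gs.
have [iU pi Ji g0 gU] := gs i (mem_head _ _); split.
  move=> a Ja; have [e [ge pe]] := alg_free_lead pp pU pi g0 gU.
  have [N JN] := lead_colon JI Ji ge Ja.
  by exists (vcomp i e (g i) ^+ N) => //; apply: primeNX.
apply: (IH _ (addi_ideal (g i) JI) us) => j js.
have [|jU pj Jj gj0 gjU] := gs j; first by rewrite in_cons js orbT.
split=> //; apply: (wgraded_addi (@vdegD n j)) => // m /gU mU; apply/eqP.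
have : j \notin supp m.
  apply: contra jU => /(subsetP mU); rewrite !inE => /predU1P[ji|//].
  by rewrite -ji js in is_.
by rewrite inE negbK /vdeg => /eqP ->.
Qed.

Lemma serre_ideal_theta l :
  (forall ts, uniq ts -> {subset ts <= cs} -> (size ts <= l)%N -> wreg srI (map theta ts)) ->
  serre_ideal l srI.
Proof.
move=> reg p pp Ip N Nl ch; have pI := prime_ideal pp; set F := prime_face p.
have FD : F \in D by apply: (prime_face_in pp).
have [U [UF pU] Umax] := alg_free_maximal F pp.
have [g gP] : exists g : 'I_n -> Q, forall i, i \in F :\: U ->
    [/\ g i <> 0, mono (fun m => supp m \subset i |: U) (g i) & p (g i)].
  have [|g gP] := @choice _ _ (fun i g => i \in F :\: U ->
    [/\ g <> 0, mono (fun m => supp m \subset i |: U) g & p g]); last by exists g.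
  by move=> i; case: (boolP (i \in F :\: U)) => [/Umax[g gP]|_]; [exists g | exists 0].
pose T1 := [seq c <- cs | c \notin [seq col v | v <- enum F]].
pose T2 := enum (F :\: U).
have T1F v : v \in F -> col v \notin T1.
  by move=> vF; rewrite mem_filter map_f // mem_enum.
(* Combine #|U| + N <= #|F0| <= size cs with size cs <= size T1 + #|F| and size T2 = #|F| - #|U|. *)
have sT : (N <= size T1 + size T2)%N.
  have [F0 F0D NF0] := pchain_bound cD pU ch; have := card_face_cs F0D.
  have : (size cs <= size T1 + #|F|)%N.
    pose inF c := c \notin [seq col v | v <- enum F].
    rewrite /T1 size_filter -(count_predC inF cs) leq_add2l.
    rewrite -size_filter cardE -(size_map col); apply: uniq_leq_size.
      exact: filter_uniq.
    by move=> c; rewrite mem_filter /= negbK => /andP[].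
  by rewrite /T2 -cardE cardsDS // => h1 h2; have := subset_leq_card UF; lia.
have uT1 : uniq T1 by apply: filter_uniq.
have T1cs : {subset T1 <= cs} by move=> c; rewrite mem_filter => /andP[].
exists (take N (map theta T1 ++ map g T2)); split.
- by rewrite size_takel // size_cat !size_map.
- move=> x /mem_take; rewrite mem_cat => /orP[/mapP[c cT ->]|/mapP[i]].
    apply: ideal_sum => // v /eqP cv; apply: contrapT => /in_prime_face vF.
    by have := T1F v vF; rewrite cv cT.
  by rewrite mem_enum => /gP[_ _ pg ->].
have II := @srI_ideal k _ _ cD.
(* In either case at most N, hence at most l, colour sums are used. *)
case: (leqP N (size T1)) => NT.
  rewrite takel_cat ?size_map // -map_take; apply: wreg_wregl => //; apply: reg.
  - exact: take_uniq.
  - by move=> c /mem_take /T1cs.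
  - by rewrite size_takel.
apply: wregl_take; apply/wregl_cat; split.
  by apply: wreg_wregl => //; apply: reg => //; apply: leq_trans Nl; apply: ltnW.
apply: (alg_free_wregl (U := U)) => //; first exact: gen_ideal.
  exact: enum_uniq.
move=> i; rewrite mem_enum => iFU; have /setDP[iF iU] := iFU.
have [gi0 giU _] := gP i iFU; split=> //; first exact/in_prime_face.
(* The colour sums of T1 do not involve 'X_i, as the colour of i occurs in F. *)
apply: (wgraded_gen (@vdegD n i)); first exact: wgraded_mono.
move=> _ /mapP[c cT ->]; exists 0 => m /theta_msupp[v cv ->].
rewrite /vdeg mnm1E; case: eqP => // vi.
by have := T1F i iF; rewrite -vi cv cT.
Qed.

End ThetaSerre.

Lemma mpoly_rmorph_id_mod (k : fieldType) (n : nat) (J : {mpoly k[n]} -> Prop)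
    (f : {rmorphism {mpoly k[n]} -> {mpoly k[n]}}) : is_ideal J ->
  (forall c, J (c%:MP - f c%:MP)) -> (forall i, J ('X_i - f 'X_i)) ->
  forall a, J (a - f a).
Proof.
move=> JI JC JX a.
have JM x y : J (x - f x) -> J (y - f y) -> J (x * y - f (x * y)).
  rewrite rmorphM => Jx Jy.
  have -> : x * y - f x * f y = x * (y - f y) + f y * (x - f x) by ring.
  by apply: idealD => //; apply: idealM.
elim/mpolyind: a => [|c m a _ _ IH]; first by rewrite rmorph0 subrr; apply: ideal0.
rewrite rmorphD opprD addrACA; apply: idealD => //.
rewrite -mul_mpolyC; apply: (JM) => //; rewrite mpolyXE_id.
apply: (big_ind (fun x => J (x - f x))) => // [|i _].
  by rewrite rmorph1 subrr; apply: ideal0.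
elim: (m i) => [|e IHe]; first by rewrite expr0 rmorph1 subrr; apply: ideal0.
by rewrite exprS; apply: JM.
Qed.

(** * Stanley-Reisner rings *)

Section StanleyReisnerRing.
Variables (k : fieldType) (T : finType) (D : simplicial_complex T).
Local Notation V := (vertices D).
Local Notation Q := {mpoly k[#|T|]}.
Local Notation R0 := {mpoly k[#|V|]}.
Local Notation I0 := (@sr_ideal k T D).

(** Every element of T becomes a variable, those outside D being non-faces. Thus D and its induced
    subcomplexes have ideals in one polynomial ring. *)
Definition ord_faces : {set {set 'I_#|T|}} :=
  [set F : {set 'I_#|T|} | enum_val @: F \in faces D].

Definition ord_set (s : {set T}) : {set 'I_#|T|} := [set i | enum_val i \in s].

Lemma ord_setK (s : {set T}) : enum_val @: ord_set s = s.
Proof.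
apply/setP => v; apply/imsetP/idP => [[i]|vs]; first by rewrite inE => ? ->.
by exists (enum_rank v); rewrite ?inE enum_rankK.
Qed.

Lemma enum_valKset (F : {set 'I_#|T|}) : ord_set (enum_val @: F) = F.
Proof. by apply/setP => i; rewrite inE mem_imset //; apply: enum_val_inj. Qed.

Lemma ord_set_faces (s : {set T}) : (ord_set s \in ord_faces) = (s \in faces D).
Proof. by rewrite inE ord_setK. Qed.

Lemma ord_faces_cplx : cplx ord_faces.
Proof.
split=> [|F G]; rewrite !inE; first by rewrite imset0 face_set0.
by move=> FD GF; apply: (face_sub FD); apply: imsetS.
Qed.

Definition sr_var (i : 'I_#|T|) : R0 :=
  if [pick j : 'I_#|V| | enum_val j == enum_val i] is Some j then 'X_j else 0.

Definition sr_down : {rmorphism Q -> R0} := mmap (@mpolyC #|V| k) sr_var.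

Definition sr_up : {rmorphism R0 -> Q} :=
  mmap (@mpolyC #|T| k) (fun j => 'X_(enum_rank (enum_val j))).

Lemma sr_upX j : sr_up 'X_j = 'X_(enum_rank (enum_val j)).
Proof. by rewrite /sr_up /= mmapX mmap1U. Qed.

Lemma sr_downX i : sr_down 'X_i = sr_var i.
Proof. by rewrite /sr_down /= mmapX mmap1U. Qed.

Lemma sr_var_in j : sr_var (enum_rank (enum_val j)) = 'X_j.
Proof.
rewrite /sr_var; case: pickP => [j'|/(_ j)]; last by rewrite enum_rankK eqxx.
by rewrite enum_rankK => /eqP/enum_val_inj ->.
Qed.

Lemma sr_var_out i : enum_val i \notin V -> sr_var i = 0.
Proof.
rewrite /sr_var; case: pickP => // j /eqP <-; by rewrite enum_valP.
Qed.

Lemma sr_upK : cancel sr_up sr_down.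
Proof.
move=> x; elim/mpolyind: x => [|c m x _ _ IH]; first by rewrite !rmorph0.
rewrite !rmorphD IH; congr (_ + _); rewrite -mul_mpolyC !rmorphM.
have -> : sr_up c%:MP = c%:MP by rewrite /sr_up /= mmapC.
have -> : sr_down c%:MP = c%:MP by rewrite /sr_down /= mmapC.
congr (_ * _); rewrite mpolyXE_id !rmorph_prod; apply: eq_bigr => j _.
by rewrite !rmorphXn sr_upX sr_downX sr_var_in.
Qed.

Lemma sr_up_face (s : {set T}) : s \subset V ->
  sr_up (face_monomial k D s) = 'X_[mset (ord_set s)].
Proof.
move=> sV; rewrite /face_monomial rmorph_prod.
under eq_bigr do rewrite sr_upX.
rewrite -(big_morph (fun m => 'X_[m]) (@mpolyXD _ k) (@mpolyX0 _ k)); congr 'X_[_].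
apply/mnmP => i; rewrite mnm_sumE mnmE inE.
have e j : U_(enum_rank (enum_val j))%MM i = (enum_val j == enum_val i :> T).
  by rewrite mnm1E -(inj_eq enum_val_inj) enum_rankK.
case: (boolP (enum_val i \in s)) => [is_|is_].
  have iV := subsetP sV _ is_; rewrite (bigD1 (enum_rank_in iV (enum_val i))) /=; last first.
    by rewrite enum_rankK_in.
  rewrite e enum_rankK_in // eqxx big1 // => j /andP[_ ne]; rewrite e.
  case: eqP => // ji; case/eqP: ne; apply: enum_val_inj; by rewrite enum_rankK_in.
rewrite big1 // => j js; rewrite e; case: eqP => // ji; by rewrite -ji js in is_.
Qed.

Lemma sr_ideal_is_ideal : is_ideal (fun f : R0 => f \in I0).
Proof.
split=> [|x y|a x]; [exact: idealr0 | exact: rpredD | exact: ring_quotient.idealMr].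
Qed.

(** Checked on variables: those of vertices are fixed, and the others are killed and lie in the
    ideal. *)
Lemma sr_down_up (a : Q) : srI ord_faces (a - sr_up (sr_down a)).
Proof.
have II := @srI_ideal k _ _ ord_faces_cplx.
apply: (mpoly_rmorph_id_mod (f := sr_up \o sr_down) II) => [c|i] /=.
  have -> : sr_down c%:MP = c%:MP by rewrite /sr_down /= mmapC.
  have -> : sr_up c%:MP = c%:MP by rewrite /sr_up /= mmapC.
  by rewrite subrr; apply: (ideal0 II).
rewrite sr_downX; case: (boolP (enum_val i \in V)) => iV.
  have -> : i = enum_rank (enum_val (enum_rank_in iV (enum_val i))).
    by rewrite enum_rankK_in // enum_valK.
  by rewrite sr_var_in sr_upX subrr; apply: (ideal0 II).
rewrite sr_var_out // rmorph0 subr0; apply/srIX; rewrite supp1 inE imset_set1.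
by apply: contra iV => /face_vertices; rewrite sub1set.
Qed.

(** A monomial supported on a non-face is divisible by a face monomial generating [I0] or by a
    variable that [sr_down] kills. *)
Lemma sr_down_ideal (a : Q) : sr_down a \in I0 <-> srI ord_faces a.
Proof.
have II := @srI_ideal k _ _ ord_faces_cplx; split.
  move=> /asboolP[r [c [g [gP e]]]]; apply: (ideal_subl II (@sr_down_up a)).
  rewrite e rmorph_sum; apply: (ideal_sum II) => i _; rewrite rmorphM; apply: (idealM II).
  have [s /andP[sV sD] ->] := gP i; rewrite sr_up_face //; apply/srIX.
  by rewrite supp_mset ord_set_faces.
have I0I := sr_ideal_is_ideal.
move=> Ia; rewrite (mpolyE a) rmorph_sum big_seq.
apply: (ideal_sum I0I) => m ma; rewrite -mul_mpolyC rmorphM; apply: (idealM I0I).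
have mD := Ia m ma; set F := supp m in mD.
have -> : m = ((m - mset F) + mset F)%MM.
  rewrite submK //; apply/mnm_lepP => i; rewrite mnmE inE.
  by case: (m i).
rewrite mpolyXD rmorphM; apply: (idealM I0I).
case: (boolP (enum_val @: F \subset V)) => [FV|/subsetPn[_ /imsetP[i iF ->] iV]].
  rewrite -(enum_valKset F) -sr_up_face // sr_upK; apply/asboolP.
  exists 1%N, (fun=> 1), (fun=> face_monomial k D (enum_val @: F)); split.
    by move=> _; exists (enum_val @: F) => //; rewrite FV; move: mD; rewrite inE.
  by rewrite big_ord1 mul1r.
have -> : mset F = ((mset F - U_(i)) + U_(i))%MM.
  rewrite submK //; apply/mnm_lepP => j; rewrite mnm1E mnmE.
  by case: eqP => // <-; rewrite iF.
by rewrite mpolyXD rmorphM sr_downX sr_var_out // mulr0; apply: (ideal0 I0I).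
Qed.

Lemma serre_sr_ring l : serre l (sr_ring k D) <-> serre_ideal l (@srI k _ ord_faces).
Proof.
pose f : {rmorphism Q -> sr_ring k D} := \pi_(sr_ring k D) \o sr_down.
apply: (@serreP _ _ _ f); first exact: srI_ideal ord_faces_cplx.
  by move=> y; exists (sr_up (repr y)); rewrite /f /= sr_upK reprK.
move=> a; rewrite -sr_down_ideal /f /=.
have := Quotient.idealrBE I0 (sr_down a) 0; rewrite subr0 => ->.
rewrite (rmorph0 (\pi_(sr_ring k D))).
by split=> [->|/eqP].
Qed.

End StanleyReisnerRing.

(** * Balanced complexes and the conclusion *)

Section Balanced.
Variables (k : fieldType) (T : finType) (d : nat) (D : simplicial_complex T).
Variables (P : 'I_d -> {set T}) (bal : balanced D P).

(* The vertices outside D, which lie in no class, get the colour d. *)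
Definition colour (i : 'I_#|T|) : nat :=
  if [pick c | enum_val i \in P c] is Some c then c : nat else d.

Lemma colourE i c : enum_val i \in P c -> colour i = c.
Proof.
move=> ic; rewrite /colour; case: pickP => [c' ic'|/(_ c)]; last by rewrite ic.
have [_ [_ dis _] _] := bal; apply/eqP; case: (c' =P c) => [->//|/eqP ne].
by have := disjointFr (dis _ _ ne) ic'; rewrite ic.
Qed.

Lemma colourP i (c : 'I_d) : colour i = c -> enum_val i \in P c.
Proof.
rewrite /colour; case: pickP => [c' ic' /val_inj <- //|_ dc].
by have := ltn_ord c; rewrite -dc ltnn.
Qed.

Lemma face_class F v : F \in ord_faces D -> v \in F -> exists c, enum_val v \in P c.
Proof.
rewrite inE => /face_vertices/subsetP FD vF; have [_ [_ _ PV] _] := bal.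
have := FD _ (imset_f _ vF); rewrite -PV => /bigcupP[c _ vc]; by exists c.
Qed.

Lemma colour_inj F v w : F \in ord_faces D -> v \in F -> w \in F ->
  colour v = colour w -> v = w.
Proof.
move=> FD vF wF; have [c vc] := face_class FD vF; rewrite (colourE vc) => /esym/colourP wc.
have [_ _ P1] := bal; apply: enum_val_inj.
have := P1 _ c (etrans (esym (in_set _ _)) FD) => /card_le1_eqP; apply.
  by rewrite in_setI wc imset_f.
by rewrite in_setI vc imset_f.
Qed.

Lemma colour_lt F v : F \in ord_faces D -> v \in F -> (colour v < d)%N.
Proof. by move=> FD vF; have [c /colourE ->] := face_class FD vF. Qed.

Lemma top_face : exists2 F, F \in ord_faces D & #|F| = d.
Proof.
have [dimD _ _] := bal; move: dimD => /addIr[dE].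
have [|s sD smax] := @eq_bigmax_cond _ (mem (faces D)) (fun s => #|s|).
  by apply/card_gt0P; exists set0; apply: face_set0.
exists (ord_set s); first by rewrite ord_set_faces.
by rewrite -dE smax -(card_imset _ enum_val_inj) ord_setK.
Qed.

End Balanced.

Theorem theorem1p3 (k : fieldType) (l : nat) (hl : (1 <= l)%N)
    (T : finType) (d : nat) (D : simplicial_complex T) (P : 'I_d -> {set T})
    (hbal : balanced D P) (hserre : serre l (sr_ring k D)) :
  forall S : {set 'I_d}, serre l (sr_ring k (rank_selected D P S)).
Proof.
(* The passage through purity requires l >= 2; for l = 1 every Stanley-Reisner ring satisfies the
   condition. *)
move=> S; apply/serre_sr_ring; case: (ltnP 1 l) => [l1|l1]; last first.
  have -> : l = 1%N by apply/eqP; rewrite eqn_leq l1 hl.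
  exact/serre_ideal1/ord_faces_cplx.
move/serre_sr_ring: hserre => Sl.
pose W := ord_set (\bigcup_(c in S) P c); have cD := ord_faces_cplx D.
have -> : ord_faces (rank_selected D P S) = induced_faces (ord_faces D) W.
  apply/setP => F; rewrite !inE; congr (_ && _).
  apply/subsetP/subsetP => h v; first by move=> vF; rewrite inE; apply/h/imset_f.
  by move=> /imsetP[i /h]; rewrite inE => iW ->.
have sub F : F \in induced_faces (ord_faces D) W -> F \in ord_faces D /\ F \subset W.
  by rewrite inE => /andP.
have colW v (c : 'I_d) : c \in S -> colour P v = c -> v \in W.
  by move=> cS /colourP vc; rewrite inE; apply/bigcupP; exists c.
(* The colours in S are those of the induced complex, and their classes lie entirely in W. *)
apply: (@serre_ideal_theta k _ (colour P) _ (induced_cplx cD W) [seq val c | c <- enum S]).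
- by rewrite map_inj_uniq ?enum_uniq //; apply: val_inj.
- by move=> F v w /sub[FD _]; apply: colour_inj FD.
- move=> F v /sub[FD /subsetP FW] /FW; rewrite inE => /bigcupP[c cS /(colourE hbal) ->].
  by apply: map_f; rewrite mem_enum.
move=> ts uts tcs tl; apply: theta_wreg_induced => // [c v /tcs/mapP[c']|].
  by rewrite mem_enum => c'S -> /colW; apply.
apply: (theta_wreg (d := d) cD _ _ _ l1 Sl) => //.
- exact: colour_inj.
- exact: colour_lt.
- exact: (top_face hbal).
- by move=> t /tcs/mapP[c _ ->]; apply: ltn_ord.
Qed.
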